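(* Let $2 \leq r \leq k$ be integers and let $H$ be a connected $n$-vertex $r$-uniform hypergraph. Unless either $H$ is a copy of $K_k^r$, or $k = r = 2$ and $H$ is a $5$-cycle, we have $$\iota(H, K_k^r) \leq \frac{n}{k+1}.$$ Moreover, $\iota(H, K_k^r) = \lfloor n/(k+1) \rfloor$ if $H$ is an $(n, K_k^r)$-good $r$-graph.
   Context: A hypergraph $H$ is a pair $(V(H), E(H))$ with $E(H)$ a family of subsets of the finite set $V(H)$; it is $r$-uniform (an $r$-graph) if every edge has exactly $r$ elements. $w \neq v$ is a neighbour of $v$ if $v,w \in e$ for some edge $e$; $N_H[v]$ is $v$ together with its neighbours, and $N_H[D] = \bigcup_{v \in D} N_H[v]$. $H$ is connected if for all distinct $v,w \in V(H)$ there are edges $e_1,\dots,e_t$ with $v \in e_1$, $w \in e_t$, $e_i \cap e_{i+1} \neq \emptyset$. For a set $X$, ${X \choose r}$ is the family of $r$-subsets of $X$; $[k] = \{1,\dots,k\}$ and $K_k^r = ([k], {[k] \choose r})$. A copy of $F$ is a hypergraph obtained by bijectively relabelling vertices of $F$; $H$ contains $F'$ if $V(F')\subseteq V(H)$, $E(F') \subseteq E(H)$. A $5$-cycle is a copy of the graph $([5], \{12,23,34,45,51\})$. $D \subseteq V(H)$ is a $K_k^r$-isolating set of $H$ if $N_H[D]$ meets the vertex set of every $K_k^r$-copy contained by $H$; $\iota(H, K_k^r)$ is the minimum size of such a set. $(n,F)$-good $r$-graphs: let $2 \leq r \leq n$, $k \in \mathbb{N}$, and $F$ a connected $k$-vertex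 $r$-graph. Write $n = q(k+1) + s$ with $q \geq 0$, $0 \leq s \leq k$. Let $Q = \{v_1, \dots, v_{q+s}\}$ be a set of size $q+s$. If $q \geq 1$, let $F_1,\dots,F_q$ be copies of $F$ such that $V(F_1),\dots,V(F_q), Q$ are pairwise disjoint; for each $i \in [q]$ let $\mathcal{W}_i$ be a nonempty family of $r$-subsets of $\{v_i\} \cup V(F_i)$ each containing $v_i$, and let $H_i$ be the $r$-graph with vertex set $\{v_i\} \cup V(F_i)$ and edge set $E(F_i) \cup \mathcal{W}_i$. $H$ is called $(n,F)$-good if either (a) $q = 0$ and $H$ is an $n$-vertex $r$-graph that is not a copy of $F$; or (b) $q \geq 1$, $T$ is a connected $r$-graph with $V(T) = Q$, $T'$ is a connected $r$-graph with $\{v_i : q < i \leq q+s\} \subseteq V(T') \subseteq \{v_i : q < i \leq q+s\} \cup V(H_q)$ and $v_q \in e$ for every $e \in E(T')$, and $H$ has vertex set $V(T') \cup \bigcup_{i=1}^q V(H_i)$ and edge set $E(T) \cup E(T') \cup \bigcup_{i=1}^q E(H_i)$. *)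

(* Defs.v *)
From HB Require Import structures.
From mathcomp Require Import all_boot all_order all_algebra.
Set Implicit Arguments.
Unset Strict Implicit.
Unset Printing Implicit Defensive.

(* A hypergraph is carried by an ambient finite type [T], its vertex set being
   an arbitrary subset of [T]; this way subhypergraphs and copies inside a given
   hypergraph are again hypergraphs over [T].  Packing both components in one
   pair makes [hypergraph T] a finType, so that copies can be quantified over
   by [[forall F' : hypergraph T, _]]. *)
Record hypergraph (T : finType) := Hypergraph {
  hval : {set T} * {set {set T}};
  hvalP : hval.2 \subset powerset hval.1 }.

HB.instance Definition _ (T : finType) := [isSub for @hval T].
HB.instance Definition _ (T : finType) := [Finite of hypergraph T by <:].

Section Hypergraphs.
Variable T : finType.
Implicit Types (H : hypergraph T) (D : {set T}) (v w : T).

Definition vset H : {set T} := (hval H).1.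
Definition eset H : {set {set T}} := (hval H).2.

Definition uniform (r : nat) H : Prop := forall e, e \in eset H -> #|e| = r.

Definition neighbour H v w : bool :=
  (w != v) && [exists e in eset H, (v \in e) && (w \in e)].

Definition cl_nbhd H v : {set T} := v |: [set w | neighbour H v w].

Definition cl_nbhd_set H D : {set T} := \bigcup_(v in D) cl_nbhd H v.

Definition connected H : Prop :=
  forall v w, v \in vset H -> w \in vset H -> v != w ->
  exists (e1 : {set T}) (es : seq {set T}),
    [/\ {subset e1 :: es <= eset H}, v \in e1, w \in last e1 es
      & path (fun e e' => e :&: e' != set0) e1 es].

Definition contains H (F' : hypergraph T) : bool :=
  (vset F' \subset vset H) && (eset F' \subset eset H).

End Hypergraphs.

Definition is_copy (U T : finType) (F : hypergraph U) (F' : hypergraph T) : bool :=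
  [exists f : {ffun U -> T},
    [&& dinjectiveb f (vset F),
        vset F' == f @: vset F
      & eset F' == [set f @: (e : {set U}) | e in eset F]]].

Definition isolating (U T : finType) (F : hypergraph U) (H : hypergraph T)
    (D : {set T}) : bool :=
  (D \subset vset H) &&
  [forall F' : hypergraph T, is_copy F F' && contains H F' ==>
     (cl_nbhd_set H D :&: vset F' != set0)].

Lemma isolating_vset (U T : finType) (F : hypergraph U) (H : hypergraph T) :
  vset F != set0 -> isolating F H (vset H).
Proof.
case/set0Pn=> u Fu; rewrite /isolating subxx; apply/forallP=> F'.
apply/implyP=> /andP[/existsP[f /and3P[_ /eqP EV _]] /andP[/subsetP sF'H _]].
apply/set0Pn; exists (f u).
have F'u : f u \in vset F' by rewrite EV imset_f.
rewrite inE F'u andbT; apply/bigcupP; exists (f u); first exact: sF'H.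
by rewrite !inE eqxx.
Qed.

(* By [isolating_vset] the default [vset H] is isolating as soon as [F] has a
   vertex, so that this is then the minimum over all isolating sets. *)
Definition isolation_number (U T : finType) (F : hypergraph U)
    (H : hypergraph T) : nat :=
  #|[arg min_(D < vset H | isolating F H D) #|D| ]|.

Lemma complete_subproof (k r : nat) :
  [set e : {set 'I_k} | #|e| == r] \subset powerset [set: 'I_k].
Proof. by apply/subsetP=> e _; rewrite inE subsetT. Qed.

Definition complete (k r : nat) : hypergraph 'I_k :=
  @Hypergraph _ (setT, [set e : {set 'I_k} | #|e| == r]) (complete_subproof k r).

Lemma cycle5_subproof :
  [set [set i; ordS i] | i : 'I_5] \subset powerset [set: 'I_5].
Proof. by apply/subsetP=> e _; rewrite inE subsetT. Qed.

(* [ordS] is the cyclic successor of 'I_5. *)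
Definition cycle5 : hypergraph 'I_5 :=
  @Hypergraph _ (setT, [set [set i; ordS i] | i : 'I_5]) cycle5_subproof.

Definition verts (T : finType) (v : nat -> T) (m p : nat) : {set T} :=
  [set x in [seq v i | i <- index_iota m p.+1]].

(* The families [v], [Fs], [W], [Hs] are indexed from 1; only their values at
   1, ..., q + s for [v] and at 1, ..., q for the others are relevant. *)
Record good_construction (U T : finType) (r q s : nat) (F : hypergraph U)
    (H : hypergraph T) (v : nat -> T) (Fs : nat -> hypergraph T)
    (W : nat -> {set {set T}}) (Hs : nat -> hypergraph T)
    (T1 T2 : hypergraph T) : Prop := GoodConstruction {
  gc_v_inj : {in [pred i | 1 <= i <= q + s] &, injective v};
  gc_copy : forall i, 1 <= i <= q -> is_copy F (Fs i);
  gc_disjQ : forall i, 1 <= i <= q ->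
    [disjoint vset (Fs i) & verts v 1 (q + s)];
  gc_disj : forall i j, 1 <= i <= q -> 1 <= j <= q -> i != j ->
    [disjoint vset (Fs i) & vset (Fs j)];
  gc_W_neq0 : forall i, 1 <= i <= q -> W i != set0;
  gc_W : forall i, 1 <= i <= q -> forall e, e \in W i ->
    [/\ #|e| = r, e \subset v i |: vset (Fs i) & v i \in e];
  gc_vsetHs : forall i, 1 <= i <= q -> vset (Hs i) = v i |: vset (Fs i);
  gc_esetHs : forall i, 1 <= i <= q -> eset (Hs i) = eset (Fs i) :|: W i;
  gc_T1_uniform : uniform r T1;
  gc_T1_connected : connected T1;
  gc_T1_vset : vset T1 = verts v 1 (q + s);
  gc_T2_uniform : uniform r T2;
  gc_T2_connected : connected T2;
  gc_T2_vset_ge : verts v q.+1 (q + s) \subset vset T2;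
  gc_T2_vset_le : vset T2 \subset verts v q.+1 (q + s) :|: vset (Hs q);
  gc_T2_eset : forall e, e \in eset T2 -> v q \in e;
  gc_vset : vset H = vset T2 :|: \bigcup_(1 <= i < q.+1) vset (Hs i);
  gc_eset : eset H =
    eset T1 :|: eset T2 :|: \bigcup_(1 <= i < q.+1) eset (Hs i) }.

(* [H] is an (n, F)-good r-graph. *)
Definition good (U T : finType) (r n : nat) (F : hypergraph U)
    (H : hypergraph T) : Prop :=
  let k := #|vset F| in
  let q := n %/ k.+1 in
  let s := n %% k.+1 in
  [/\ 2 <= r <= n, 0 < k, uniform r F, connected F &
      (q = 0 /\ [/\ #|vset H| = n, uniform r H & ~ is_copy F H])
   \/ (1 <= q /\ exists v Fs W Hs T1 T2,
         @good_construction U T r q s F H v Fs W Hs T1 T2)].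

(* Main.v *)
(* Every copy of K_k^r in H spans a k-clique of the 2-shadow of H (the graph of
   the relation [neighbour H]), and domination is the same in H and in its
   shadow, so the bound follows from its graph version: a connected graph on n
   vertices has a set of at most n / (k+1) vertices whose closed neighbourhood
   meets all k-cliques, unless it is K_k, or k = 2 and it is a 5-cycle.

   The graph version goes by induction on n.  Let v have maximum degree, N = N[v],
   and call the components of V - N violating the bound bad; by induction they
   are cliques K_k or 5-cycles, and each is linked to some x in N.
   - No bad component: take v and the union of the sets of the components.
   - Some x in N is linked to two bad components: take v, one linked vertex for
     each bad component (x for both), and few vertices in each component.
   - Otherwise remove x and a bad J linked to it; what is left consists of the
     component A of v and of components satisfying the bound.  If A satisfies it
     too, add to its set one or two vertices of J dominating J and x.  If
     A = K_k, then A = N - x, the maximum degree is k, and x alone isolates A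
     and J, unless k = 2 and the graph is a 5-cycle.  If A is a 5-cycle vbcdf,
     then {c, d} is a bad component linked to f; removing it with f gives either
     the bound, or |J| = 2 and a vertex of J adjacent to b, and then b and v
     isolate A, J and x.

   For a good H, the closed neighbourhoods of the V(F_i) are pairwise disjoint
   and an isolating set meets each of them, whence the lower bound; H is not a
   5-cycle because v_1 would have degree at least 3. *)

Require Import Defs.
From HB Require Import structures.
From mathcomp Require Import all_boot all_order all_algebra zify.
Set Implicit Arguments.
Unset Strict Implicit.
Unset Printing Implicit Defensive.
Import Order.TTheory GRing.Theory Num.Theory.

(* [lia] on the goal alone, where cardinals are first made atomic. *)
Ltac card_lia :=
  repeat match goal with |- context [card ?A] => generalize (card A) end;
  clear; lia.

(** * Isolation of cliques in graphs *)

Section Graph.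
Variables (T : finType) (e : rel T).
Hypothesis e_sym : symmetric e.
Implicit Types (x y z : T) (A B C D J R S V W X Z : {set T}).

(* Locked, so that rewriting with [inE] stops at [y \in nbhd x]. *)
Definition nbhd x : {set T} := locked [set y | (y == x) || e x y].

Lemma in_nbhd x y : (y \in nbhd x) = (y == x) || e x y.
Proof. by rewrite /nbhd -lock inE. Qed.

Lemma nbhd_sym x y : (y \in nbhd x) = (x \in nbhd y).
Proof. by rewrite !in_nbhd eq_sym e_sym. Qed.

Lemma nbhd_refl x : x \in nbhd x.
Proof. by rewrite in_nbhd eqxx. Qed.

Definition dom D : {set T} := \bigcup_(x in D) nbhd x.

Lemma domU D D' : dom (D :|: D') = dom D :|: dom D'.
Proof. by rewrite /dom bigcup_setU. Qed.

Lemma dom1 x : dom [set x] = nbhd x.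
Proof. by rewrite /dom big_set1. Qed.

Lemma nbhd_dom x D : x \in D -> nbhd x \subset dom D.
Proof. by move=> Dx; apply: bigcup_sup. Qed.

Definition clique C : bool := [forall x in C, C \subset nbhd x].

Lemma cliqueP C :
  reflect (forall x y, x \in C -> y \in C -> y \in nbhd x) (clique C).
Proof.
apply: (iffP forall_inP) => [H x y Cx|H x Cx]; first exact: (subsetP (H x Cx)).
by apply/subsetP=> y; apply: H.
Qed.

(* [S] is a union of components of the subgraph induced by [W]. *)
Definition closedin W S : bool :=
  (S \subset W) && [forall x in S, nbhd x :&: W \subset S].

Lemma closedinP W S :
  reflect (S \subset W /\
           forall x y, x \in S -> y \in W -> y \in nbhd x -> y \in S)
          (closedin W S).
Proof.
apply: (iffP andP) => -[sSW clS]; split=> //.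
  by move=> x y Sx Wy xy; apply: (subsetP (forall_inP clS x Sx)); rewrite inE xy.
by apply/forall_inP=> x Sx; apply/subsetP=> y /setIP[xy Wy]; apply: clS Wy xy.
Qed.

Lemma closedinD W S : closedin W S -> closedin W (W :\: S).
Proof.
move=> /closedinP[sSW clS]; apply/closedinP; split; first exact: subsetDl.
move=> x y /setDP[Wx S'x] Wy xy; rewrite inE Wy andbT; apply: contra S'x => Sy.
by apply: clS Sy Wx _; rewrite nbhd_sym.
Qed.

Lemma closedin_trans W V S : closedin W V -> closedin V S -> closedin W S.
Proof.
move=> /closedinP[sVW clV] /closedinP[sSV clS]; apply/closedinP.
split; first exact: subset_trans sVW.
move=> x y Sx Wy xy; apply: (clS x) => //; apply: (clV x) => //.
exact: (subsetP sSV _ Sx).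
Qed.

Lemma closedinI W V S : closedin W S -> V \subset W -> closedin V (V :&: S).
Proof.
move=> /closedinP[sSW clS] sVW; apply/closedinP; split; first exact: subsetIl.
move=> x y /setIP[_ Sx] Vy xy; rewrite inE Vy.
by apply: clS xy => //; apply: (subsetP sVW).
Qed.

(** Hence a clique lies in a single component, and [hits] can be checked on each component
    separately. *)
Lemma clique_closed W S C z :
  closedin W S -> clique C -> C \subset W -> z \in C -> z \in S -> C \subset S.
Proof.
move=> /closedinP[_ clS] /cliqueP cC sCW Cz Sz; apply/subsetP=> y Cy.
by apply: clS Sz (subsetP sCW y Cy) (cC _ _ Cz Cy).
Qed.

(* Connectedness as the absence of cuts, so that no walk has to be handled. *)
Definition conn W : bool :=
  [forall S : {set T}, closedin W S ==> (S != set0) ==> (S == W)].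

Lemma connP W :
  reflect (forall S, closedin W S -> S != set0 -> S = W) (conn W).
Proof.
apply: (iffP forallP) => [H S cS S0|H S].
  by have := H S; rewrite cS S0 => /eqP.
by apply/implyP=> cS; apply/implyP=> S0; apply/eqP; apply: H.
Qed.

Definition comp W J : bool := [&& J != set0, closedin W J & conn J].

Lemma comp_sub W J S z :
  comp W J -> closedin W S -> z \in J -> z \in S -> J \subset S.
Proof.
case/and3P=> _ cJ /connP coJ cS Jz Sz; apply/setIidPl; apply: coJ.
  by apply: closedinI cS _; case/closedinP: cJ.
by apply/set0Pn; exists z; rewrite inE Jz.
Qed.

Lemma comp_eq W J K z : comp W J -> comp W K -> z \in J -> z \in K -> J = K.
Proof.
move=> cJ cK Jz Kz; apply/eqP; rewrite eqEsubset.
have [[_ clJ _] [_ clK _]] := (and3P cJ, and3P cK).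
by rewrite (comp_sub cJ clK Jz Kz) (comp_sub cK clJ Kz Jz).
Qed.

(** A minimal closed set containing [z] is connected: a closed part missing [z] could be cut off. *)
Lemma comp_ex W z : z \in W -> exists2 J, comp W J & z \in J.
Proof.
move=> Wz; have PW : closedin W W && (z \in W).
  by rewrite Wz andbT; apply/closedinP.
have [J minJ _] := @minset_exists _ (fun S => closedin W S && (z \in S)) _ PW.
have [/andP[cJ Jz] mJ] := minsetP minJ; exists J => //.
apply/and3P; split=> //; first by apply/set0Pn; exists z.
apply/connP=> S cS S0; have [Sz|S'z] := boolP (z \in S).
  by apply: mJ; [rewrite Sz (closedin_trans cJ) | case/closedinP: cS].
have: J :\: S = J.
  by apply: mJ; rewrite ?subsetDl // inE S'z Jz (closedin_trans cJ) ?closedinD.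
case/set0Pn: S0 => y Sy E; have [sSJ _] := closedinP _ _ cS.
by have := subsetP sSJ y Sy; rewrite -E inE Sy.
Qed.

Definition comps W := [set J | comp W J].

Lemma comps_partition W : partition (comps W) W.
Proof.
apply/and3P; split.
- rewrite /cover; apply/eqP/setP=> z; apply/bigcupP/idP.
    by case=> J; rewrite inE => /and3P[_ /closedinP[/subsetP sJW _] _]; apply: sJW.
  by case/comp_ex=> J cJ Jz; exists J; rewrite // inE.
- apply/trivIsetP=> J K; rewrite !inE => cJ cK nJK.
  apply/pred0P=> z /=; apply/negP=> /andP[Jz Kz].
  by case/eqP: nJK; exact: (comp_eq cJ cK Jz Kz).
by rewrite inE /comp eqxx.
Qed.

(** * Sets isolating the [k]-cliques, and the exceptional graphs *)

Variable k : nat.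
Hypothesis k_gt1 : 1 < k.

(* [D] isolates the [k]-cliques of the subgraph induced by [W], but need not be
   contained in [W]. *)
Definition hits W D : bool :=
  [forall C : {set T}, [&& C \subset W, clique C & #|C| == k] ==>
     ~~ [disjoint dom D & C]].

Lemma hitsP W D :
  reflect (forall C, C \subset W -> clique C -> #|C| = k ->
             [disjoint dom D & C] -> False) (hits W D).
Proof.
apply: (iffP forallP) => [H C sC cC kC dC|H C].
  by have := H C; rewrite sC cC kC eqxx dC.
by apply/implyP=> /and3P[sC cC /eqP kC]; apply/negP; apply: H.
Qed.

Lemma hits_sub W W' D D' :
  W \subset W' -> D' \subset D -> hits W' D' -> hits W D.
Proof.
move=> sW sD /hitsP hD; apply/hitsP=> C sC cC kC dC.
apply: (hD C) => //; first exact: subset_trans sW.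
apply: disjointWl dC; apply/bigcupsP=> x Dx; apply: nbhd_dom.
exact: (subsetP sD).
Qed.

Lemma hitsU W D D' : hits (W :\: dom D) D' -> hits W (D :|: D').
Proof.
move=> /hitsP hD; apply/hitsP=> C sC cC kC; rewrite domU.
rewrite disjoint_sym disjoints_subset setCU subsetI -!disjoints_subset.
case/andP=> dC dC'; apply: (hD C) => //; last by rewrite disjoint_sym.
by rewrite subsetD sC.
Qed.

(** [Z] stands for the vertices that are already dominated. *)
Lemma hits_comps W Z (D : {set T} -> {set T}) :
  (forall J, J \in comps W -> hits (J :\: Z) (D J)) ->
  hits (W :\: Z) (\bigcup_(J in comps W) D J).
Proof.
move=> hD; apply/hitsP=> C sC cC kC dC.
have [z Cz]: exists z, z \in C by apply/set0Pn; rewrite -card_gt0 kC ltnW.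
have [sCW dCZ] : C \subset W /\ [disjoint C & Z].
  by apply/andP; rewrite -subsetD.
have [J cJ Jz] := comp_ex (subsetP sCW z Cz).
have iJ : J \in comps W by rewrite inE.
have [_ clJ _] := and3P cJ.
move/hitsP: (hD J iJ); apply; [|exact: cC|exact: kC|].
  by rewrite subsetD (clique_closed clJ cC sCW Cz Jz).
apply: disjointWl dC; apply/bigcupsP=> x Dx; apply: nbhd_dom.
by apply/bigcupP; exists J.
Qed.

Lemma hits_small W D : #|W| < k -> hits W D.
Proof. by move=> ltWk; apply/hitsP=> C /subset_leq_card ? _ ?; lia. Qed.

Definition bounded V : bool :=
  [exists D : {set T}, [&& D \subset V, hits V D & #|D| * k.+1 <= #|V|]].

Lemma boundedP V :
  reflect (exists D, [/\ D \subset V, hits V D & #|D| * k.+1 <= #|V|])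
          (bounded V).
Proof. by apply: (iffP existsP) => -[D hD]; exists D; apply/and3P. Qed.

Lemma card_bigcup_le (I : finType) (P : {set I}) (D : I -> {set T}) :
  #|\bigcup_(i in P) D i| <= \sum_(i in P) #|D i|.
Proof.
elim/big_rec2: _ => [|i n A _ IH]; first by rewrite cards0.
by have := (leq_card_setU (D i) A).1; lia.
Qed.

Lemma bounded_comps W : (forall J, comp W J -> bounded J) -> bounded W.
Proof.
move=> bW.
have /fin_all_exists[D hD] : forall J, exists D, comp W J ->
    [/\ D \subset J, hits J D & #|D| * k.+1 <= #|J|].
  move=> J; case cJ: (comp W J); last by exists set0.
  by have /boundedP[D ?] := bW J cJ; exists D.
apply/boundedP; exists (\bigcup_(J in comps W) D J); split.
- apply/bigcupsP=> J; rewrite inE => cJ; have [sD _ _] := hD J cJ.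
  by case/and3P: cJ => _ /closedinP[sJ _] _; apply: subset_trans sJ.
- have := @hits_comps W set0 D; rewrite setD0; apply=> J; rewrite inE setD0.
  by case/hD.
rewrite (card_partition (comps_partition W)).
apply: leq_trans (leq_mul (card_bigcup_le _ _) (leqnn _)) _.
by rewrite big_distrl leq_sum //= => J; rewrite inE => /hD[].
Qed.

Lemma bounded_closed W A :
  closedin W A -> bounded A -> bounded (W :\: A) -> bounded W.
Proof.
move=> clA /boundedP[D [sD hD cD]] /boundedP[D' [sD' hD' cD']].
have [sAW _] := closedinP _ _ clA.
apply/boundedP; exists (D :|: D'); split.
- by rewrite subUset (subset_trans sD) ?(subset_trans sD') ?subsetDl.
- apply/hitsP=> C sC cC kC dC.
  have [z Cz]: exists z, z \in C by apply/set0Pn; rewrite -card_gt0 kC ltnW.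
  have dCU (E : {set T}) : E \subset D :|: D' -> [disjoint dom E & C].
    move=> sE; apply: disjointWl dC; apply/bigcupsP=> x Ex; apply: nbhd_dom.
    exact: (subsetP sE).
  have [Az|A'z] := boolP (z \in A).
    apply: (hitsP _ _ hD C) => //; last by rewrite dCU ?subsetUl.
    exact: clique_closed clA cC sC Cz Az.
  apply: (hitsP _ _ hD' C) => //; last by rewrite dCU ?subsetUr.
  apply: (clique_closed (closedinD clA) cC sC Cz).
  by rewrite in_setD A'z (subsetP sC).
have := (leq_card_setU D D').1; have := cardsID A W; rewrite (setIidPr sAW); nia.
Qed.

(** The basic reduction: [Z] is dominated by [D] and large enough to pay for it, so only the rest
    matters. *)
Lemma bounded_step V Z D :
  D \subset V -> Z \subset V -> Z \subset dom D -> #|D| * k.+1 <= #|Z| ->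
  bounded (V :\: Z) -> bounded V.
Proof.
move=> sDV sZV sZD cD /boundedP[D' [sD' hD' cD']].
apply/boundedP; exists (D :|: D'); split.
- by rewrite subUset sDV (subset_trans sD') ?subsetDl.
- by apply: hitsU; apply: hits_sub hD'; rewrite ?setDS.
have := (leq_card_setU D D').1; have := cardsID Z V; rewrite (setIidPr sZV); nia.
Qed.

(* A 2-regular graph on 5 vertices is a 5-cycle; see [cyc5_explicit]. *)
Definition cyc5 V : bool :=
  [&& k == 2, #|V| == 5 & [forall x in V, #|nbhd x :&: V| == 3]].

Definition exc V : bool := (#|V| == k) && clique V || cyc5 V.

Lemma cyc5P V :
  reflect [/\ k = 2, #|V| = 5 & forall x, x \in V -> #|nbhd x :&: V| = 3]
          (cyc5 V).
Proof.
apply: (iffP and3P) => -[/eqP k2 /eqP V5 H]; split=> //.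
  by move=> x Vx; apply/eqP; apply: (forall_inP H).
by apply/forall_inP=> x /H ->.
Qed.

(** Turns degrees into counts of Booleans, so that adjacencies among five listed vertices are
    settled by computation. *)
Lemma cardIs A (s : seq T) : uniq s -> #|A :&: [set:: s]| = count (mem A) s.
Proof.
move=> us; rewrite -size_filter -(card_uniqP (filter_uniq _ us)).
by apply: eq_card => z; rewrite !inE mem_filter.
Qed.

(** [y] has two neighbours [b], [f] and two non-neighbours [c], [d]; the degrees fix the rest up to
    exchanging [c] and [d]. *)
Lemma cyc5_explicit V y : cyc5 V -> y \in V ->
  exists b c d f, [/\ V = [set:: [:: y; b; c; d; f]], uniq [:: y; b; c; d; f],
    [/\ b \in nbhd y, c \in nbhd b, d \in nbhd c, f \in nbhd d & f \in nbhd y]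
    & [/\ c \notin nbhd y, d \notin nbhd y, d \notin nbhd b, f \notin nbhd b
        & f \notin nbhd c]].
Proof.
case/cyc5P=> k2 V5 reg Vy.
have yN : y \in nbhd y :&: V by rewrite inE nbhd_refl.
have /cards2P[b [f [nbf E1]]] : #|(nbhd y :&: V) :\ y| == 2.
  by have := cardsD1 y (nbhd y :&: V); rewrite yN reg // add1n => -[<-].
have /cards2P[c [d [ncd E2]]] : #|V :\: nbhd y| == 2.
  by have := cardsID (nbhd y) V; rewrite setIC reg // V5 => /eqP.
have [] : [/\ b != y, b \in nbhd y & b \in V].
  by apply/and3P; rewrite -in_setI -in_setD1 E1 !inE eqxx.
have [] : [/\ f != y, f \in nbhd y & f \in V].
  by apply/and3P; rewrite -in_setI -in_setD1 E1 !inE eqxx orbT.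
have [] : c \notin nbhd y /\ c \in V.
  by apply/andP; rewrite -in_setD E2 !inE eqxx.
have [] : d \notin nbhd y /\ d \in V.
  by apply/andP; rewrite -in_setD E2 !inE eqxx orbT.
move=> yd Vd yc Vc fy yf Vf b_y yb Vb.
have ne p q : p \in nbhd y -> q \notin nbhd y -> (p == q) = false.
  by move=> yp; apply: contraNF => /eqP <-.
have us : uniq [:: y; b; c; d; f].
  rewrite /= !inE !(eq_sym y) (negPf b_y) (negPf fy) (negPf nbf) (negPf ncd).
  by rewrite !(eq_sym c y, eq_sym d y, eq_sym c f, eq_sym d f) !ne ?nbhd_refl.
have EV : [set:: [:: y; b; c; d; f]] = V.
  apply/eqP; rewrite eqEcard cardsE (card_uniqP us) V5 leqnn andbT.
  by apply/subsetP=> z; rewrite !inE => /or4P[||| /orP[]] /eqP->.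
have deg x : x \in V -> count (mem (nbhd x)) [:: y; b; c; d; f] = 3.
  by move=> Vx; rewrite -cardIs // EV reg.
move: (deg b Vb) (deg c Vc) (deg d Vd) (deg f Vf) => /=.
rewrite !nbhd_refl (nbhd_sym b y) (nbhd_sym c y) (nbhd_sym d y) (nbhd_sym f y).
rewrite (nbhd_sym c b) (nbhd_sym d b) (nbhd_sym f b).
rewrite (nbhd_sym d c) (nbhd_sym f c) (nbhd_sym f d) yb yf (negPf yc) (negPf yd).
(* If [b] and [f] were adjacent, [y], [b], [f] would have no further neighbours, and the degrees of
   [c] and [d] would be too small. *)
case: (boolP (f \in nbhd b)) => bf.
  by do 5!case: (boolP (_ \in _)) => ?.
case bc: (c \in nbhd b); case bd: (d \in nbhd b);
  case cd: (d \in nbhd c); case cf: (f \in nbhd c);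
  case df: (f \in nbhd d) => // _ _ _ _.
- by exists b, c, d, f; split=> //; split=> //; apply/negbT.
have us' : uniq [:: y; b; d; c; f].
  by move: us; rewrite /= !inE (eq_sym d c); do 9!case: (_ == _).
exists b, d, c, f; split=> //.
- by rewrite -EV; apply/setP=> z; rewrite !inE (orbCA (z == c)).
- by split=> //; rewrite nbhd_sym.
by split=> //; apply/negbT.
Qed.

(* Once a vertex [x] adjacent to [J] has been selected, isolating what remains
   of [J] costs so little that [k] vertices of [J] are left over. *)
Lemma exc_near J x : exc J -> nbhd x :&: J != set0 ->
  exists D, [/\ D \subset J, hits (J :\: nbhd x) D & #|D| * k.+1 + k <= #|J|].
Proof.
move=> eJ /set0Pn[y /setIP[xy Jy]].
case/orP: eJ => [/andP[/eqP Jk _]|/cyc5P[k2 J5 reg]].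
  (* The clique loses [y], so fewer than [k] of its vertices remain. *)
  exists set0; rewrite sub0set cards0 Jk; split=> //; apply: hits_small.
  rewrite -Jk proper_card // properEneq subsetDl andbT; apply/eqP=> E.
  by move: Jy; rewrite -E inE xy.
(* Such a [z] leaves two vertices of the 5-cycle undominated; one of them is [y], which [x]
   dominates. *)
have [z] : exists z, z \in J :\: nbhd y.
  by apply/set0Pn; rewrite -card_gt0 cardsD setIC reg // J5.
rewrite inE => /andP[yz Jz]; exists [set z]; rewrite sub1set Jz cards1 J5 k2.
split=> //; rewrite -(setU0 [set z]); apply: hitsU; apply: hits_small.
rewrite dom1 k2; have := cardsID (nbhd z) J; rewrite setIC reg // J5.
have sub : J :\: nbhd x :\: nbhd z \subset (J :\: nbhd z) :\ y.
  apply/subsetP=> t; rewrite !(in_setD, in_set1) => /and3P[-> xt ->].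
  by rewrite !andbT; apply: contraNneq xt => ->.
have := subset_leq_card sub; have := cardsD1 y (J :\: nbhd z).
by rewrite in_setD Jy nbhd_sym yz; lia.
Qed.

(** In a clique, a vertex [y] of [J] in [nbhd x] suffices. In a 5-cycle, [y] and a vertex at
    distance two do; they cost 6, which is [#|J|.+1]. *)
Lemma exc_cover J x : exc J -> nbhd x :&: J != set0 ->
  exists D, [/\ D \subset J, x |: J \subset dom D & #|D| * k.+1 <= #|J|.+1].
Proof.
move=> eJ /set0Pn[y /setIP[xy Jy]]; case/orP: eJ => [/andP[/eqP Jk /cliqueP cJ]|cJ].
  exists [set y]; rewrite sub1set Jy cards1 Jk mul1n; split=> //.
  by rewrite dom1 subUset sub1set nbhd_sym xy; apply/subsetP=> z; apply: cJ.
have [b [c [d [f [EJ us [yb bc cd _ fy] _]]]]] := cyc5_explicit cJ Jy.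
have [k2 J5 _] := cyc5P _ cJ.
exists [set y; c]; rewrite J5 k2; split; last by rewrite cards2; case: (_ != _).
  by rewrite subUset !sub1set Jy EJ !inE eqxx !orbT.
rewrite domU !dom1 EJ; apply/subsetP=> z /setU1P[->|].
  by rewrite in_setU nbhd_sym xy.
rewrite in_setU in_set !in_cons orbF => /or4P[||| /orP[]] /eqP->.
- by rewrite nbhd_refl.
- by rewrite yb.
- by rewrite nbhd_refl orbT.
- by rewrite cd orbT.
- by rewrite fy.
Qed.

(** * The induction step around a vertex [v] of maximum degree *)

Section Step.
Variables (V : {set T}) (v : T).
Hypothesis coV : conn V.
Hypothesis IH : forall J, J \proper V -> conn J -> bounded J \/ exc J.
Hypothesis Vv : v \in V.
Let N := nbhd v :&: V.
Hypothesis maxN : forall w, w \in V -> #|nbhd w :&: V| <= #|N|.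
Hypothesis ltkN : k < #|N|.
Let V' := V :\: N.

(* By [IH] such a component is a [k]-clique or a 5-cycle. *)
Let bad J := comp V' J && ~~ bounded J.
Let linked x J := nbhd x :&: J != set0.

Let Nv : v \in N. Proof. by rewrite inE nbhd_refl. Qed.

Let compP J : comp V' J -> [/\ J \subset V, v \notin J & J \proper V].
Proof.
case/and3P=> _ /closedinP[sJ _] _.
have v'J : v \notin J by apply/negP=> /(subsetP sJ); rewrite inE Nv.
have sJV : J \subset V by apply: subset_trans sJ (subsetDl _ _).
by split=> //; apply/properP; split=> //; exists v.
Qed.

Let bad_exc J : bad J -> exc J.
Proof.
case/andP=> cJ /negPf nbJ; have [_ _ pJ] := compP cJ.
by case/and3P: cJ => _ _ /(IH pJ); rewrite nbJ => -[].
Qed.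

(** Otherwise [J] would be closed in [V], hence equal to [V], although it misses [v]. *)
Lemma comp_linked J : comp V' J -> exists2 x, x \in N & linked x J.
Proof.
move=> cJ; apply/exists_inP; apply: contraT; rewrite negb_exists_in.
move=> /forall_inP unl; have [sJV v'J _] := compP cJ.
have [J0 /closedinP[_ clJ] _] := and3P cJ.
case/negP: v'J; rewrite (connP _ coV J) //; apply/closedinP; split=> // x y Jx Vy xy.
have [Ny|N'y] := boolP (y \in N); last by apply: clJ Jx _ xy; rewrite inE N'y.
have := unl y Ny; rewrite negbK => /eqP/setP/(_ x).
by rewrite !inE Jx nbhd_sym xy.
Qed.

Let linked_neq J x : comp V' J -> linked x J -> x != v.
Proof.
move=> cJ /set0Pn[y /setIP[xy Jy]]; apply: contraTneq xy => ->.
case/and3P: cJ => _ /closedinP[/subsetP sJ _] _; move/sJ: Jy.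
by rewrite !inE => /andP[/nandP[/negP//|/negPf->]].
Qed.

(** [v] dominates [N], whose more than [k] vertices pay for it. *)
Lemma step_no_bad : (forall J, ~~ bad J) -> bounded V.
Proof.
move=> nb; apply: (@bounded_step V N [set v]); rewrite ?sub1set ?subsetIr //.
- by rewrite dom1 subsetIl.
- by rewrite cards1 mul1n.
by apply: bounded_comps => J cJ; have := nb J; rewrite /bad cJ negbK.
Qed.

(** Of the cost [k.+1] of a vertex of [X], one unit is paid by that vertex, which lies in [N], and
    [k] units by the savings of [exc_near] on a bad component; these suffice as [#|X| <= #|B|]. *)
Lemma step_double x J1 J2 : x \in N -> bad J1 -> bad J2 -> J1 != J2 ->
  linked x J1 -> linked x J2 -> bounded V.
Proof.
move=> Nx bJ1 bJ2 nJ12 l1 l2.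
(* [l] selects a linked vertex for each bad component, and [x] whenever possible. *)
have /fin_all_exists[l hl] : forall J, exists y, bad J ->
    [/\ y \in N, linked y J & linked x J -> y = x].
  move=> J; case bJ: (bad J); last by exists x.
  have [lx|nlx] := boolP (linked x J); first by exists x.
  by have [y Ny ly] := comp_linked (proj1 (andP bJ)); exists y.
have /fin_all_exists[D hD] : forall J, exists D, comp V' J ->
    [/\ D \subset J, hits (J :\: (if bad J then nbhd (l J) else set0)) D
      & #|D| * k.+1 + (k * bad J) <= #|J|].
  move=> J; case cJ: (comp V' J); last by exists set0.
  case bJ: (bad J); last first.
    move/negbT: bJ; rewrite /bad cJ negbK => /boundedP[D [sD hD cD]].
    by exists D; rewrite setD0 muln0 addn0.
  have [_ ll _] := hl J bJ; rewrite muln1.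
  by have [D ?] := exc_near (bad_exc bJ) ll; exists D.
pose B := [set J | bad J]; pose X := v |: l @: B.
have sXN : X \subset N.
  rewrite subUset sub1set Nv; apply/subsetP=> y /imsetP[J].
  by rewrite inE => /hl[Nl _ _] ->.
(* [l] takes the value [x] at both [J1] and [J2], which makes room for [v]. *)
have cX : #|X| <= #|B|.
  suff ltB : #|l @: B| < #|B|.
    by apply: leq_trans (leq_card_setU _ _).1 _; rewrite cards1.
  rewrite ltn_neqAle leq_imset_card andbT; apply/imset_injP => inj.
  case/eqP: nJ12; apply: inj; rewrite ?inE //.
  by have [[_ _ E1] [_ _ E2]] := (hl _ bJ1, hl _ bJ2); rewrite E1 // E2.
apply/boundedP; exists (X :|: \bigcup_(J in comps V') D J); split.
- rewrite subUset (subset_trans sXN) ?subsetIr //; apply/bigcupsP=> J.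
  rewrite inE => cJ; have [sD _ _] := hD J cJ; have [sJ _ _] := compP cJ.
  exact: subset_trans sJ.
- apply: hitsU; apply: (@hits_sub _ (V' :\: dom X)) (subxx _) _.
    apply/subsetP=> y; rewrite !in_setD => /andP[X'y Vy]; rewrite X'y Vy andbT /=.
    apply: contra X'y => /setIP[vy _]; apply: (subsetP (nbhd_dom _)) vy.
    exact: setU11.
  apply: hits_comps => J; rewrite inE => cJ; have [_ hDJ _] := hD J cJ.
  apply: hits_sub hDJ => //; apply: setDS; case: ifP => bJ; last exact: sub0set.
  by apply: nbhd_dom; rewrite setU1r ?imset_f // inE.
have E1 : \sum_(J in comps V') (#|D J| * k.+1 + k * bad J) <= #|V'|.
  rewrite (card_partition (comps_partition V')); apply: leq_sum => J.
  by rewrite inE => /hD[].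
have E2 : \sum_(J in comps V') bad J = #|B|.
  rewrite -sum1_card [RHS]big_mkcond [LHS]big_mkcond; apply: eq_bigr => J _ /=.
  by rewrite !inE /bad; case: (comp _ _); case: (bounded _).
move: E1; rewrite big_split -big_distrl -big_distrr /= E2 => E1.
rewrite -(cardsID N V) (setIidPr (subsetIr _ _)) -/V'.
apply: leq_trans (leq_mul (leq_card_setU _ _).1 (leqnn _)) _; rewrite mulnDl.
apply: leq_trans (leq_add (leqnn _) (leq_mul (card_bigcup_le _ _) (leqnn _))) _.
apply: leq_trans (leq_add (leqnn _) E1); rewrite mulnS (mulnC k) addnCA addnC.
by apply: leq_add => //; rewrite leq_add ?leq_mul ?subset_leq_card.
Qed.

(* [J] is the only bad component linked to [x]: it is removed together with [x],
   at the cost given by [exc_cover]. *)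
Section Remove.
Variables (x : T) (J : {set T}).
Hypotheses (Nx : x \in N) (bJ : bad J) (lJ : linked x J).
Hypothesis onlyJ : forall K, bad K -> linked x K -> K = J.
Let W := V :\: (x |: J).

Let clJ : closedin V' J. Proof. by case/andP: bJ => /and3P[]. Qed.
Let sJV' : J \subset V'. Proof. by case/closedinP: clJ. Qed.
Let N'J z : z \in J -> z \notin N.
Proof. by move/(subsetP sJV'); rewrite in_setD => /andP[]. Qed.

Let Wv : v \in W.
Proof.
rewrite in_setD Vv andbT; apply/negP=> /setU1P[vx|/N'J]; last by rewrite Nv.
by have := linked_neq (proj1 (andP bJ)) lJ; rewrite vx eqxx.
Qed.

Let inW z : z \in V' -> z \notin J -> z \in W.
Proof.
rewrite !in_setD in_setU1 => /andP[N'z ->] /negPf->; rewrite orbF andbT.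
by apply: contraNneq N'z => ->.
Qed.

Section Comp.
Variable A : {set T}.
Hypotheses (Av : v \in A) (clA : closedin W A).

Let sAW : A \subset W. Proof. by case/closedinP: clA. Qed.

Lemma remove_nbhd : N :\ x \subset A.
Proof.
have [_ hA] := closedinP _ _ clA; apply/subsetP=> u /setD1P[nux Nu].
have [vu Vu] := setIP Nu; apply: hA Av _ vu.
by rewrite in_setD Vu andbT in_setU1 (negPf nux); apply/negP=> /N'J; rewrite Nu.
Qed.

Let sRV' : W :\: A \subset V'.
Proof.
apply/subsetP=> z /setDP[Wz A'z]; have [Vz] := setDP Wz.
rewrite in_setU1 => /norP[nzx J'z]; rewrite in_setD Vz andbT.
by apply: contra A'z => Nz; apply: (subsetP remove_nbhd); rewrite in_setD1 nzx.
Qed.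

(** [W :\: A] lies in [V'], where [J] is closed, so it has no neighbour in [J] either. *)
Lemma remove_closed : closedin (V :\ x) (W :\: A).
Proof.
have [_ hR] := closedinP _ _ (closedinD clA); have [_ hJ] := closedinP _ _ clJ.
apply/closedinP; split.
  by apply: subset_trans (subsetDl _ _) (setDS _ (subsetUl _ _)).
move=> t u Rt /setD1P[nux Vu] tu; apply: hR (Rt) _ (tu).
rewrite in_setD Vu in_setU1 (negPf nux) andbT; apply/negP=> Ju.
have Jt : t \in J by apply: hJ Ju (subsetP sRV' _ Rt) _; rewrite nbhd_sym.
by have [Wt _] := setDP Rt; move: Wt; rewrite in_setD in_setU1 Jt orbT.
Qed.

(** An unbounded component [K] would be bad in [V']. It is not linked to [x], by [onlyJ], nor to
    other vertices of [N], as these lie in the closed set [A]; this contradicts [comp_linked]. *)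
Lemma remove_rest : bounded (W :\: A).
Proof.
apply: bounded_comps => K cK; apply: contraT => nbK.
have [K0 clK coK] := and3P cK; have [sKR _] := closedinP _ _ clK.
have clKW : closedin W K := closedin_trans (closedinD clA) clK.
have [_ hKW] := closedinP _ _ clKW; have [_ hJ] := closedinP _ _ clJ.
have cKV : comp V' K.
  apply/and3P; split=> //; apply/closedinP; split; first exact: subset_trans sRV'.
  move=> t u Kt V'u tu; apply: hKW (Kt) _ (tu); apply: inW => //.
  have Rt := subsetP sKR t Kt; apply/negP=> Ju.
  have Jt : t \in J by apply: hJ Ju (subsetP sRV' _ Rt) _; rewrite nbhd_sym.
  by have [Wt _] := setDP Rt; move: Wt; rewrite in_setD in_setU1 Jt orbT.
have bK : bad K by rewrite /bad cKV.
have [z Kz] := set0Pn _ K0; have /setDP[Wz A'z] := subsetP sKR z Kz.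
have [y Ny ly] := comp_linked cKV.
have nyx : y != x.
  apply: contraTneq Wz => yx; rewrite in_setD in_setU1.
  by rewrite -(onlyJ bK) ?Kz ?orbT // -yx.
have Ay : y \in A by apply: (subsetP remove_nbhd); rewrite in_setD1 nyx.
have [t /setIP[yt Kt]] := set0Pn _ ly.
have /setDP[Wt /negP[]] := subsetP sKR t Kt.
by have [_ hA] := closedinP _ _ clA; apply: hA Ay Wt yt.
Qed.

Lemma remove_bounded : bounded A -> bounded V.
Proof.
move=> bA; have bW := bounded_closed clA bA remove_rest.
have [D [sD sDom cD]] := exc_cover (bad_exc bJ) lJ.
have sJV : J \subset V by apply: subset_trans sJV' (subsetDl _ _).
apply: (@bounded_step V (x |: J) D) => //.
- exact: subset_trans sJV.
- by rewrite subUset sub1set sJV andbT; case/setIP: Nx.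
by rewrite cardsU1; have /negPf-> : x \notin J by apply: (contraL (@N'J x)).
Qed.

End Comp.

Lemma remove_cases : bounded V \/
  exists A, [/\ v \in A, closedin W A, conn A & exc A].
Proof.
have [A cA Av] := comp_ex Wv; have [_ clA coA] := and3P cA.
have pA : A \proper V.
  have [sA _] := closedinP _ _ clA; apply/properP; split.
    exact: subset_trans sA (subsetDl _ _).
  have Vx : x \in V by case/setIP: Nx.
  by exists x => //; apply/negP=> /(subsetP sA); rewrite !inE eqxx.
by case: (IH pA coA) => [/(remove_bounded Av clA)|]; [left | right; exists A].
Qed.

Let Vx : x \in V. Proof. by case/setIP: Nx. Qed.
Let sJV : J \subset V. Proof. exact: subset_trans sJV' (subsetDl _ _). Qed.
Let J'x : x \notin J. Proof. by apply: (contraL (@N'J x)). Qed.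

Section Split.
Variable A : {set T}.
Hypotheses (Av : v \in A) (clA : closedin W A).
Let R := W :\: A.

Let sAW : A \subset W. Proof. by case/closedinP: clA. Qed.

Let dAJ : [disjoint A & J].
Proof.
apply/pred0P=> z /=; apply: contraTF (sAW) => /andP[Az Jz].
by apply/subsetPn; exists z; rewrite // in_setD in_setU1 Jz orbT.
Qed.

Lemma remove_card : #|V| = 1 + #|J| + #|A| + #|R|.
Proof.
rewrite -(cardsID (x |: J) V) (setIidPr _); last by rewrite subUset sub1set Vx.
by rewrite cardsU1 J'x -/W -(cardsID A W) (setIidPr sAW) addnA.
Qed.

Lemma remove_mem z : z \in V -> [\/ z = x, z \in J, z \in A | z \in R].
Proof.
move=> Vz; have [->|nzx] := eqVneq z x; first by constructor 1.
have [Jz|J'z] := boolP (z \in J); first by constructor 2.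
have [Az|A'z] := boolP (z \in A); first by constructor 3.
by constructor 4; rewrite !inE A'z (negPf nzx) (negPf J'z).
Qed.

(* The rest [R] is attached to the other vertices only through [x]. *)
Lemma remove_hits D D' :
  x \in dom D -> hits R D' -> hits ((A :|: J) :\: dom D) set0 ->
  hits V (D :|: D').
Proof.
move=> Dx /hitsP hD' /hitsP hD; apply: hitsU; apply/hitsP=> C sC cC kC dC.
have [[sCV dCD] [z Cz]] : (C \subset V /\ [disjoint C & dom D]) /\ exists z, z \in C.
  split; first by apply/andP; rewrite -subsetD.
  by apply/set0Pn; rewrite -card_gt0 kC ltnW.
have C'x : x \notin C by apply: contraL Dx => /(disjointFr dCD) ->.
have sCx : C \subset V :\ x by rewrite subsetD1 sCV.
have [/existsP[t /andP[Ct Rt]]|] := boolP [exists t, (t \in C) && (t \in R)].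
  apply: (hD' C) => //.
  exact: clique_closed (remove_closed Av clA) cC sCx Ct Rt.
rewrite negb_exists => /forallP nR; apply: (hD C) => //; last first.
  by rewrite /dom big_set0; apply/pred0P=> t; rewrite /= inE.
rewrite subsetD dCD andbT; apply/subsetP=> t Ct; rewrite inE.
have := nR t; rewrite Ct /=; case: (remove_mem (subsetP sCV t Ct)) => [tx|->|->|->] //.
  by rewrite -tx Ct in C'x.
by rewrite orbT.
Qed.

Lemma remove_clique : #|A| = k -> clique A -> bounded V \/ exc V.
Proof.
move=> Ak /cliqueP cA.
have NA : N :\ x = A.
  apply/eqP; rewrite eqEcard remove_nbhd // Ak.
  by move: ltkN; rewrite (cardsD1 x) Nx.
have Nk : #|N| = k.+1 by have := cardsD1 x N; rewrite NA Ak Nx.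
have [y /setIP[xy Jy]] := set0Pn _ lJ.
have sAV : A \subset V by apply: subset_trans sAW (subsetDl _ _).
(* If [J] were a 5-cycle, then [y], also adjacent to [x], would have a closed neighbourhood of size
   4 > [k.+1]. *)
have [Jk /cliqueP cJ] : #|J| = k /\ clique J.
  case/orP: (bad_exc bJ) => [/andP[/eqP-> ->] //|/cyc5P[k2 _ /(_ y Jy) y3]].
  have : #|x |: (nbhd y :&: J)| <= #|nbhd y :&: V|.
    apply: subset_leq_card; rewrite subUset sub1set inE nbhd_sym xy Vx /=.
    exact: setIS.
  move/leq_trans/(_ (maxN (subsetP sJV y Jy))).
  by rewrite cardsU1 in_setI (negPf J'x) andbF y3 Nk k2.
have /boundedP[D [sD hD cD]] := remove_rest Av clA.
have [hx|] := boolP (hits ((A :|: J) :\: nbhd x) set0).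
  left; apply/boundedP; exists ([set x] :|: D); split.
  - rewrite subUset sub1set Vx (subset_trans sD) //.
    by rewrite /R /W -!setDDl !(subset_trans (subsetDl _ _)).
  - by apply: remove_hits => //; rewrite dom1 ?nbhd_refl.
  rewrite remove_card Jk Ak.
  apply: leq_trans (leq_mul (leq_card_setU _ _).1 (leqnn _)) _.
  by rewrite mulnDl cards1 mul1n leq_add // add1n leq_addr.
(* [C] misses [v] in [A] and [y] in [J], each of size [k], so it is contained in neither and meets
   both. *)
case/forallPn=> C; rewrite negb_imply => /andP[/and3P[sC /cliqueP cC /eqP Ck] _].
have vx : v \in nbhd x by rewrite nbhd_sym; case/setIP: Nx.
have [sCAJ dCx] : C \subset A :|: J /\ [disjoint C & nbhd x].
  by apply/andP; rewrite -subsetD.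
have C'v : v \notin C by apply/negP=> /(disjointFr dCx); rewrite vx.
have C'y : y \notin C by apply/negP=> /(disjointFr dCx); rewrite xy.
have cAJ : #|C :&: A| + #|C :&: J| = k.
  rewrite -Ck -{3}(setIidPl sCAJ) setIUr cardsU setIACA (disjoint_setI0 dAJ).
  by rewrite setI0 cards0 subn0.
have pA : #|C :&: A| < k.
  rewrite -Ak; apply: proper_card; apply/properP; split; first exact: subsetIr.
  by exists v; rewrite // inE (negPf C'v).
have pJ : #|C :&: J| < k.
  rewrite -Jk; apply: proper_card; apply/properP; split; first exact: subsetIr.
  by exists y; rewrite // inE (negPf C'y).
(* The [k]-clique [A1] fills all but one of the at most [k.+1] places in the closed neighbourhood of
   [t]. *)
have deg (A1 A2 : {set T}) (t : T) : [disjoint A1 & A2] -> t \in C :&: A1 ->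
    A1 \subset V -> A2 \subset V -> #|A1| = k ->
    (forall p q, p \in A1 -> q \in A1 -> q \in nbhd p) -> #|C :&: A2| <= 1.
  move=> d12 /setIP[Ct At] s1 s2 k1 c1.
  have : #|A1 :|: (C :&: A2)| <= #|nbhd t :&: V|.
    have sV : C :&: A2 \subset V := subset_trans (subsetIr _ _) s2.
    apply: subset_leq_card; rewrite subsetI !subUset s1 sV !andbT.
    apply/andP; split; apply/subsetP=> q; first exact: c1.
    by case/setIP=> Cq _; apply: cC.
  move=> /leq_trans/(_ (maxN (subsetP s1 t At))); rewrite Nk cardsU k1.
  rewrite setICA (disjoint_setI0 d12) setI0 cards0.
  by rewrite subn0 -addn1 leq_add2l.
have [z CJz] : exists z, z \in C :&: J.
  by apply/set0Pn; rewrite -card_gt0; move: cAJ pA; card_lia.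
have [u CAu] : exists u, u \in C :&: A.
  by apply/set0Pn; rewrite -card_gt0; move: cAJ pJ; card_lia.
have cA1 : #|C :&: A| <= 1 by apply: (deg J A z) => //; rewrite disjoint_sym.
have cJ1 : #|C :&: J| <= 1 by apply: (deg A J u).
have k2 : k = 2 by move: k_gt1 cAJ cA1 cJ1; card_lia.
have [[Cz Jz] [Cu Au]] := (setIP CJz, setIP CAu).
have nAJ p q : p \in A -> q \in J -> (p == q) = false.
  by move=> Ap; apply: contraTF => /eqP <-; rewrite (disjointFr dAJ).
have A'x : x \notin A.
  by apply/negP=> /(subsetP sAW); rewrite !inE eqxx.
have nvu : (v == u) = false by apply: contraNF C'v => /eqP->.
have nyz : (y == z) = false by apply: contraNF C'y => /eqP->.
have nxA p : p \in A -> (x == p) = false by apply: contraTF => /eqP<-.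
have nxJ p : p \in J -> (x == p) = false by apply: contraTF => /eqP<-.
have Vz := subsetP sJV z Jz; have Vy := subsetP sJV y Jy.
have Vu := subsetP sAV u Au.
have us : uniq [:: v; x; y; z; u].
  rewrite /= !inE nvu nyz (eq_sym v x) (eq_sym y u) (eq_sym z u).
  by rewrite !(nxA v, nxA u, nxJ y, nxJ z) // !nAJ.
(* Closed neighbourhoods now have at most three vertices, so two known neighbours are all of
   them. *)
have three w p q : uniq [:: w; p; q] -> w \in V -> p \in V -> q \in V ->
    p \in nbhd w -> q \in nbhd w ->
    nbhd w :&: V = [set:: [:: w; p; q]] /\ #|nbhd w :&: V| = 3.
  move=> us3 Vw Vp Vq wp wq; suff E : nbhd w :&: V = [set:: [:: w; p; q]].
    by rewrite E cardsE (card_uniqP us3).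
  apply/eqP; rewrite eq_sym eqEcard [X in _ <= X]cardsE (card_uniqP us3).
  rewrite (leq_trans (maxN Vw)) ?Nk ?k2 // andbT; apply/subsetP=> t.
  rewrite in_set !in_cons orbF inE.
  by case/or3P=> /eqP->; rewrite ?nbhd_refl ?wp ?wq ?Vw ?Vp ?Vq.
have u3 (p q t : T) : p != q -> p != t -> q != t -> uniq [:: p; q; t].
  by move=> pq pt qt; rewrite /= !inE negb_or pq pt qt.
have := us; rewrite /= !inE !negb_or.
case/and5P=> [/and4P[ne1 ne2 ne3 ne4] /and3P[ne5 ne6 ne7] /andP[ne8 ne9] ne10 _].
have nsym (p q : T) : p != q -> q != p by rewrite eq_sym.
have [xv yx] : x \in nbhd v /\ y \in nbhd x by split=> //; case/setIP: Nx.
have xy' : x \in nbhd y by rewrite nbhd_sym.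
have [zy yz] : z \in nbhd y /\ y \in nbhd z by split; apply: cJ.
have [uz zu] : u \in nbhd z /\ z \in nbhd u by split; apply: cC.
have [uv vu] : u \in nbhd v /\ v \in nbhd u by split; apply: cA.
pose S := [set:: [:: v; x; y; z; u]].
have Sin t : t \in S -> nbhd t :&: V \subset S /\ #|nbhd t :&: V| = 3.
  have sub (l : seq T) : all (mem [:: v; x; y; z; u]) l -> [set:: l] \subset S.
    by move/allP=> sl; apply/subsetP=> q; rewrite !in_set; apply: sl.
  rewrite in_set !in_cons orbF => /or4P[||| /orP[]] /eqP->.
  - have [-> ->] := three v x u (u3 _ _ _ ne1 ne4 ne7) Vv Vx Vu xv uv.
    by split=> //; apply: sub; rewrite /= !inE !eqxx !orbT.
  - have [-> ->] := three x v y (u3 _ _ _ (nsym _ _ ne1) ne5 ne2) Vx Vv Vy vx yx.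
    by split=> //; apply: sub; rewrite /= !inE !eqxx !orbT.
  - have [-> ->] := three y x z (u3 _ _ _ (nsym _ _ ne5) ne8 ne6) Vy Vx Vz xy' zy.
    by split=> //; apply: sub; rewrite /= !inE !eqxx !orbT.
  - have [-> ->] := three z y u (u3 _ _ _ (nsym _ _ ne8) ne10 ne9) Vz Vy Vu yz uz.
    by split=> //; apply: sub; rewrite /= !inE !eqxx !orbT.
  have [-> ->] := three u v z (u3 _ _ _ (nsym _ _ ne4) (nsym _ _ ne10) ne3) Vu Vv Vz vu zu.
  by split=> //; apply: sub; rewrite /= !inE !eqxx !orbT.
have VS : S = V.
  apply: (connP _ coV); last by apply/set0Pn; exists v; rewrite in_set mem_head.
  apply/closedinP; split.
    by apply/subsetP=> t; rewrite in_set !in_cons orbF => /or4P[||| /orP[]] /eqP->.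
  by move=> p q Sp Vq pq; apply: (subsetP (proj1 (Sin p Sp))); rewrite inE pq.
right; apply/orP; right; apply/cyc5P; split=> //.
  by rewrite -VS cardsE (card_uniqP us).
by move=> t; rewrite -{1}VS => /Sin[].
Qed.

End Split.

End Remove.

(** * The case of at most one bad component at each vertex of [N] *)

Hypothesis only : forall x J K, x \in N -> bad J -> bad K ->
  linked x J -> linked x K -> K = J.

Let bad_card J : bad J -> k <= #|J|.
Proof.
case/andP=> _; apply: contraR; rewrite -ltnNge => ltJk; apply/boundedP.
by exists set0; rewrite sub0set cards0 hits_small.
Qed.

(* For two bad components [H] and [B], where [H] linked to [x] and [B] linked to
   [p], and a further neighbour [o] of [v]: deleting [B] and [p] leaves [v], [o], [x]
   and [H] in one component, which is exceptional only if these vertices form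
   a 5-cycle. *)
Lemma step_second x y z H p B o :
  k = 2 -> bad H -> bad B -> [disjoint H & B] -> x \in N -> p \in N -> o \in N ->
  uniq [:: v; p; o; x] -> linked p B -> y \in H -> y \in nbhd x ->
  z \in H -> z != y ->
  bounded V \/ #|H| = 2 /\ z \in nbhd o.
Proof.
move=> k2 bH bB dHB Nx Np No us lB Hy xy Hz nzy.
have lH : linked x H by apply/set0Pn; exists y; rewrite inE xy.
have onlyB K : bad K -> linked p K -> K = B by move=> bK lK; apply: only lB lK.
case: (remove_cases Np bB lB onlyB) => [|[A [Av clA coA eA]]]; first by left.
right; have sNA := remove_nbhd bB Av clA.
move: us; rewrite /= !inE !negb_or => /and4P[/and3P[nvp nvo nvx] /andP[npo npx] nox _].
have Ao : o \in A by apply: (subsetP sNA); rewrite in_setD1 No eq_sym npo.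
have Ax : x \in A by apply: (subsetP sNA); rewrite in_setD1 Nx eq_sym npx.
have /and3P[_ clH coH] := proj1 (andP bH).
have [sHV' hH] := closedinP _ _ clH.
have N'H t : t \in H -> t \notin N by move/(subsetP sHV'); rewrite in_setD => /andP[].
have sHW : H \subset V :\: (p |: B).
  apply/subsetP=> t Ht; rewrite in_setD in_setU1 (disjointFr dHB Ht) orbF.
  have /setDP[-> N't] := subsetP sHV' t Ht; rewrite andbT.
  by apply: contraNneq N't => ->.
have [_ hA] := closedinP _ _ clA.
have Ay : y \in A by apply: hA Ax (subsetP sHW y Hy) xy.
have sHA : H \subset A.
  apply/setIidPl; apply: (connP _ coH); first exact: closedinI clA sHW.
  by apply/set0Pn; exists y; rewrite inE Hy.
have neH t q : t \in N -> q \in H -> (t == q) = false.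
  by move=> Nt; apply: contraTF => /eqP <-; apply: contraL Nt => /N'H.
pose s := [:: v; o; x; y; z].
have us : uniq s.
  rewrite /= !inE (negPf nvo) (negPf nvx) (negPf nox) !(neH v, neH o, neH x) //.
  by rewrite eq_sym (negPf nzy).
have ss : [set:: s] \subset A.
  apply/subsetP=> t; rewrite in_set !in_cons orbF.
  by case/or4P=> [||| /orP[]] /eqP-> //; apply: (subsetP sHA).
(* Five vertices are too many for a 2-clique, so [A] is a 5-cycle on exactly [s]. *)
have c5 : 5 <= #|A| by have := subset_leq_card ss; rewrite cardsE (card_uniqP us).
case/orP: eA => [/andP[/eqP Ak _]|]; first by rewrite Ak k2 in c5.
case/cyc5P=> _ A5 reg.
have EA : [set:: s] = A by apply/eqP; rewrite eqEcard ss A5 cardsE (card_uniqP us).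
have H2 : #|H| = 2.
  suff -> : H = [set y; z] by rewrite cards2 eq_sym nzy.
  apply/eqP; rewrite eqEsubset subUset !sub1set Hy Hz !andbT.
  apply/subsetP=> t Ht; have := subsetP sHA t Ht; rewrite -EA in_set !in_cons orbF.
  by rewrite !(eq_sym t) !(neH v, neH o, neH x) //= !inE !(eq_sym t).
split=> //; have /cliqueP cH : clique H.
  by case/orP: (bad_exc bH) => [/andP[]|/cyc5P[_]] //; rewrite H2.
have deg t : t \in A -> count (mem (nbhd t)) s = 3.
  by move=> At; rewrite -cardIs // EA reg.
have [xv ov] : v \in nbhd x /\ v \in nbhd o.
  by split; rewrite nbhd_sym; [case/setIP: Nx | case/setIP: No].
(* The two neighbours of [x] are [v] and [y], those of [y] are [x] and [z]; so besides [v], [o] can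
   only have [z]. *)
move: (deg x Ax) (deg y Ay) (deg o Ao) => /=.
rewrite !nbhd_refl xy xv ov (nbhd_sym y x) xy (cH y z) // (nbhd_sym x o) (nbhd_sym y o).
by do !case: (_ \in _).
Qed.

Lemma step_single x H : x \in N -> bad H -> linked x H -> bounded V \/ exc V.
Proof.
move=> Nx bH lH; have onlyH K (bK : bad K) (lK : linked x K) := only Nx bH bK lH lK.
case: (remove_cases Nx bH lH onlyH) => [|[A [Av clA coA]]]; first by left.
case/orP=> [/andP[/eqP Ak cA]|cA]; first exact: (remove_clique Nx bH lH onlyH Av clA).
have [k2 A5 _] := cyc5P _ cA; left.
have [b [c [d [f [EA us [vb bc cd df vf] [vc vd _ _ _]]]]]] := cyc5_explicit cA Av.
have [sAW hA] := closedinP _ _ clA; have /and3P[_ clH _] := proj1 (andP bH).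
have [sHV' hH] := closedinP _ _ clH.
have sAV : A \subset V := subset_trans sAW (subsetDl _ _).
have inA t : t \in [:: v; b; c; d; f] -> t \in A by rewrite EA in_set.
have [Ab Ac Ad Af] : [/\ b \in A, c \in A, d \in A & f \in A].
  by split; apply: inA; rewrite !inE eqxx ?orbT.
have A'x : x \notin A by apply/negP=> /(subsetP sAW); rewrite !inE eqxx.
have dHA : [disjoint H & A].
  apply/pred0P=> t /=; apply: contraTF (sAW) => /andP[Ht At].
  by apply/subsetPn; exists t; rewrite // in_setD in_setU1 Ht orbT.
(* On the cycle only [b] and [f] are adjacent to [v], so the edge [cd] lies outside [N] and turns
   out to be a bad component. *)
pose B := [set c; d].
have sBA : B \subset A by rewrite subUset !sub1set Ac.
have Bin t : t \in B -> t \in V'.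
  by case/set2P=> ->; rewrite in_setD in_setI ?(negPf vc) ?(negPf vd) (subsetP sAV).
have bB : bad B.
  apply/andP; split.
    apply/and3P; split; first by apply/set0Pn; exists c; rewrite set21.
      apply/closedinP; split; first exact/subsetP.
      move=> q t Bq V't qt; have Aq := subsetP sBA q Bq; have /setDP[Vt N't] := V't.
      have At : t \in A.
        apply: hA (Aq) _ (qt); rewrite in_setD Vt andbT in_setU1; apply/norP; split.
          by apply: contraNneq N't => ->.
        apply/negP=> Ht; have := hH t q Ht (Bin q Bq); rewrite nbhd_sym.
        by move/(_ qt); rewrite (disjointFl dHA).
      move: N't At; rewrite in_setI Vt andbT EA in_set !in_cons orbF => N't.
      case/or4P=> [/eqP E|/eqP E|/eqP->| /orP[/eqP->|/eqP E]]; rewrite ?set21 ?set22 //.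
      - by rewrite E nbhd_refl in N't.
      - by rewrite E vb in N't.
      by rewrite E vf in N't.
    apply/connP=> S /closedinP[sS hS] /set0Pn[q Sq]; apply/eqP; rewrite eqEsubset sS.
    apply/subsetP=> t Bt; have Bq := subsetP sS q Sq; apply: hS Sq (Bt) _.
    by case/set2P: Bq => ->; case/set2P: Bt => ->; rewrite ?nbhd_refl // nbhd_sym.
  (* Two vertices cannot pay the cost 3 of a vertex, and [B] is itself a 2-clique. *)
  apply/negP=> /boundedP[D [_ hD cD]].
  have ncd : c != d by move: us; rewrite /= !inE !negb_or => /and5P[_ _ /andP[]].
  have B2 : #|B| = 2 by rewrite cards2 ncd.
  have D0 : D = set0 by apply/eqP; rewrite -cards_eq0; move: cD; rewrite B2 k2; case: #|D|.
  move/hitsP: hD; apply; [exact: subxx| |by rewrite B2|].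
    apply/cliqueP=> q t; case/set2P=> -> /set2P[]->; rewrite ?nbhd_refl //.
    by rewrite nbhd_sym.
  by rewrite D0 /dom big_set0; apply/pred0P=> t; rewrite /= inE.
have [y /setIP[xy Hy]] := set0Pn _ lH.
have [z /setD1P[nzy Hz]] : exists z, z \in H :\ y.
  apply/set0Pn; rewrite -card_gt0; have := bad_card bH.
  by rewrite k2 (cardsD1 y H) Hy.
have Nb : b \in N by rewrite inE vb (subsetP sAV).
have Nf : f \in N by rewrite inE vf (subsetP sAV).
have nxA t : t \in A -> (t == x) = false by apply: contraTF => /eqP->.
have us' : uniq [:: v; f; b; x].
  move: us; rewrite /= !inE !nxA // !negb_or (eq_sym f b).
  by case/and5P=> /and4P[-> _ _ ->] /and3P[_ _ ->].
have lfB : linked f B by apply/set0Pn; exists d; rewrite inE nbhd_sym df set22.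
have dHB : [disjoint H & B] by apply: disjointWr dHA.
(* The second removal deletes [f] and [B]; [b] is the further neighbour of [v]. *)
case: (step_second k2 bH bB dHB Nx Nf Nb us' lfB Hy xy Hz nzy) => [//|[H2 bz]].
have /boundedP[D [sD hD cD]] := remove_rest Nx bH onlyH Av clA.
apply/boundedP; exists ([set b; v] :|: D); split.
- rewrite !subUset !sub1set Vv (subsetP sAV) //=; apply: subset_trans sD _.
  by rewrite !(subset_trans (subsetDl _ _)).
- have dbv t : t \in dom [set b; v] = (t \in nbhd b) || (t \in nbhd v).
    by rewrite domU !dom1 inE.
  apply: (remove_hits bH Av clA) => //.
    by rewrite dbv orbC; case/setIP: Nx => ->.
  (* In [A :|: H] only [y] and [d] can escape [b] and [v], and they are not adjacent since [H] is
     closed in [V']. *)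
  apply/hitsP=> C sC /cliqueP cC Ck _.
  have sCyd : C \subset [set y; d].
    apply/subsetP=> t /(subsetP sC); rewrite in_setD dbv in_setU.
    case/andP=> /norP[bt vt] /orP[].
      rewrite EA in_set !in_cons orbF.
      case/or4P=> [/eqP E|/eqP E|/eqP E| /orP[/eqP->|/eqP E]]; rewrite ?set22 //.
      - by rewrite E nbhd_refl in vt.
      - by rewrite E nbhd_refl in bt.
      - by rewrite E bc in bt.
      by rewrite E vf in vt.
    move=> Ht; suff -> : t = y by rewrite set21.
    apply: contraNeq bt => nty; suff -> : t = z by [].
    apply/eqP; have: #|H :\ y| == 1 by move: H2; rewrite (cardsD1 y) Hy add1n => -[->].
    case/cards1P=> w Ew; have t1 : t \in H :\ y by rewrite in_setD1 nty.
    have z1 : z \in H :\ y by rewrite in_setD1 nzy.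
    by move: t1 z1; rewrite Ew => /set1P-> /set1P->.
  have EC : C = [set y; d].
    by apply/eqP; rewrite eqEcard sCyd Ck k2 cards2; case: (_ != _).
  have yd : d \in nbhd y by apply: cC; rewrite EC ?set21 ?set22.
  have := hH y d Hy (Bin d (set22 _ _)) yd.
  by rewrite (disjointFl dHA Ad).
(* [b] and [v] cost 6, while [x], [H] and [A] provide 8 vertices. *)
rewrite (remove_card Nx bH clA) H2 A5 k2.
rewrite k2 in cD; apply: leq_trans (leq_mul (leq_card_setU _ _).1 (leqnn _)) _.
by rewrite mulnDl leq_add // cards2; case: (_ != _).
Qed.

End Step.

Theorem bounded_or_exc V : conn V -> bounded V \/ exc V.
Proof.
have [n] := ubnP #|V|; elim: n V => // n IHn V ltVn coV.
have IH J : J \proper V -> conn J -> bounded J \/ exc J.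
  by move/proper_card=> ltJ; apply: IHn; apply: leq_trans ltJ ltVn.
have [h0|] := boolP (hits V set0).
  by left; apply/boundedP; exists set0; rewrite sub0set cards0.
case/forallPn=> C; rewrite negb_imply => /andP[/and3P[sC cC /eqP Ck] _].
have [CV|nCV] := eqVneq C V; first by right; rewrite /exc -CV Ck eqxx cC.
(* By connectedness some vertex of [C] has a neighbour outside [C]. *)
have [w Cw ltw] : exists2 w, w \in C & k < #|nbhd w :&: V|.
  have C0 : C != set0 by rewrite -card_gt0 Ck ltnW.
  apply/exists_inP; apply: contraT; rewrite negb_exists_in => /forall_inP small.
  case/negP: nCV; apply/eqP; apply: (connP _ coV) => //; apply/closedinP; split=> //.
  move=> x y Cx Vy xy; suff -> : C = nbhd x :&: V by rewrite inE xy.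
  apply/eqP; rewrite eqEcard Ck leqNgt small // andbT subsetI sC andbT.
  exact: (forall_inP cC).
have [v Vv maxv] := arg_maxnP (fun x => #|nbhd x :&: V|) (subsetP sC w Cw).
have maxN x : x \in V -> #|nbhd x :&: V| <= #|nbhd v :&: V| by apply: maxv.
have ltkN : k < #|nbhd v :&: V| by apply: leq_trans ltw (maxN _ (subsetP sC w Cw)).
have nbad := @step_no_bad V v Vv ltkN.
pose bad J := comp (V :\: (nbhd v :&: V)) J && ~~ bounded J.
have [none|] := boolP [forall J, ~~ bad J]; first by left; apply: nbad; apply/forallP.
case/forallPn=> H; rewrite negbK => bH.
pose linked x J := nbhd x :&: J != set0.
have [/existsP[x /existsP[J /existsP[K]]]|only] := boolP [exists x, exists J, exists K,
    (x \in nbhd v :&: V) && [&& bad J, bad K, linked x J, linked x K & K != J]].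
  case/andP=> Nx /and5P[bJ bK lJ lK nKJ]; left.
  exact: (step_double coV IH Vv Nx bK bJ nKJ lK lJ).
have [x Nx lx] := comp_linked coV Vv (proj1 (andP bH)).
apply: (step_single coV IH Vv maxN ltkN _ Nx bH lx) => y J K Ny bJ bK lJ lK.
apply: contraNeq only => nKJ; apply/existsP; exists y; apply/existsP; exists J.
by apply/existsP; exists K; apply/andP; split=> //; apply/and5P.
Qed.

End Graph.

(** * From hypergraphs to their shadows *)

Section Shadow.
Variables (T : finType) (H : hypergraph T).
Implicit Types (x y : T) (D : {set T}).

Lemma neighbour_sym : symmetric (neighbour H).
Proof.
move=> x y; rewrite /neighbour eq_sym; congr (_ && _).
by apply: eq_existsb => e; rewrite [(x \in e) && _]andbC.
Qed.

Lemma cl_nbhdE x : cl_nbhd H x = nbhd (neighbour H) x.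
Proof. by apply/setP=> y; rewrite in_nbhd !inE. Qed.

Lemma cl_nbhd_setE D : cl_nbhd_set H D = dom (neighbour H) D.
Proof. by apply: eq_bigr => x _; rewrite cl_nbhdE. Qed.

Lemma edge_sub (e : {set T}) : e \in eset H -> e \subset vset H.
Proof. by move/(subsetP (hvalP H)); rewrite inE. Qed.

Lemma edge_nbhd (e : {set T}) x y :
  e \in eset H -> x \in e -> y \in e -> y \in nbhd (neighbour H) x.
Proof.
move=> He ex ey; rewrite in_nbhd /neighbour; case: eqP => //= _.
by apply/exists_inP; exists e; rewrite // ex.
Qed.

(** An edge that meets a closed set lies in it, so a chain of edges starting in [S] stays in [S]. *)
Lemma connected_conn : connected H -> conn (neighbour H) (vset H).
Proof.
move=> coH; apply/connP=> S /closedinP[sSV clS] /set0Pn[x Sx].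
apply/eqP; rewrite eqEsubset sSV; apply/subsetP=> y Vy.
have [->//|nyx] := eqVneq y x; rewrite eq_sym in nyx.
have [e1 [es [ses xe1 yes pes]]] := coH x y (subsetP sSV x Sx) Vy nyx.
have subS e z : e \in eset H -> z \in e -> z \in S -> e \subset S.
  move=> He ez Sz; apply/subsetP=> t et; apply: clS Sz _ (edge_nbhd He ez et).
  exact: (subsetP (edge_sub He)).
suff /subsetP/(_ y yes) : last e1 es \subset S by [].
have e1S : e1 \subset S by apply: subS xe1 Sx; apply: ses; rewrite mem_head.
elim: es e1 {xe1 yes} ses pes e1S => //= e2 es IHes e1 ses /andP[/set0Pn[z]] .
rewrite inE => /andP[ez1 ez2] pes e1S; apply: IHes pes _.
  by move=> e es_e; apply: ses; rewrite inE es_e orbT.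
by apply: subS ez2 (subsetP e1S z ez1); apply: ses; rewrite !inE eqxx orbT.
Qed.

End Shadow.

Lemma subset_card_ex (I : finType) (A : {set I}) m :
  #|A| <= m <= #|I| -> exists2 B : {set I}, A \subset B & #|B| = m.
Proof.
elim: m => [|m IHm] /andP[leA lem].
  by exists A => //; apply/eqP; rewrite -leqn0.
have [ltA|] := ltnP #|A| m.+1; last by exists A => //; apply/eqP; rewrite eqn_leq leA.
have [B sAB Bm] : exists2 B : {set I}, A \subset B & #|B| = m.
  by apply: IHm; rewrite -ltnS ltA ltnW.
have [x B'x] : exists x, x \in ~: B.
  by apply/set0Pn; rewrite -card_gt0 cardsCs setCK Bm subn_gt0.
exists (x |: B); first exact: subset_trans sAB (subsetUr _ _).
by rewrite cardsU1 Bm; move: B'x; rewrite inE => ->.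
Qed.

Section Isolation.
Variables (T U : finType) (F : hypergraph U) (H : hypergraph T).
Hypothesis F0 : vset F != set0.

Lemma isolation_number_le (D : {set T}) :
  isolating F H D -> isolation_number F H <= #|D|.
Proof.
move=> iD; rewrite /isolation_number.
by case: arg_minnP => [|D' _]; [apply: isolating_vset | apply].
Qed.

Lemma isolation_number_ge m :
  (forall D : {set T}, isolating F H D -> m <= #|D|) -> m <= isolation_number F H.
Proof.
move=> mD; rewrite /isolation_number.
by case: arg_minnP => [|D' iD' _]; [apply: isolating_vset | apply: mD].
Qed.

End Isolation.

(** * Copies of complete hypergraphs *)

Section Complete.
Variables (T : finType) (k r : nat).
Hypotheses (r_gt1 : 1 < r) (le_rk : r <= k).
Implicit Types H F : hypergraph T.

Lemma is_copy_complete F1 : is_copy (complete k r) F1 ->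
  #|vset F1| = k /\
  exists2 f : {ffun 'I_k -> T}, injective f &
    vset F1 = f @: setT /\
    eset F1 = [set f @: (e : {set 'I_k}) | e in [set e : {set 'I_k} | #|e| == r]].
Proof.
case/existsP=> f /and3P[/dinjectiveP inj /eqP EV /eqP EE].
have finj : injective f by move=> i j; apply: inj; rewrite inE.
split; first by rewrite EV card_imset // cardsT card_ord.
by exists f.
Qed.

(** As [2 <= r <= k], any two vertices extend to an [r]-set, which is an edge. *)
Lemma copy_clique H F1 : is_copy (complete k r) F1 -> contains H F1 ->
  clique (neighbour H) (vset F1).
Proof.
case/is_copy_complete=> _ [f finj [EV EE]] /andP[_ sE].
apply/cliqueP=> x y; rewrite EV => /imsetP[i _ ->] /imsetP[j _ ->].
have [|e sije er] := @subset_card_ex _ [set i; j] r.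
  rewrite card_ord le_rk andbT; apply: leq_trans r_gt1.
  by rewrite cards2; case: (_ != _).
apply: (@edge_nbhd _ _ (f @: e)); rewrite ?imset_f ?(subsetP sije) ?set21 ?set22 //.
by apply: (subsetP sE); rewrite EE imset_f // inE er.
Qed.

Lemma complete_vset0 : vset (complete k r) != set0.
Proof. by rewrite -card_gt0 cardsT card_ord (leq_trans _ le_rk) // ltnW. Qed.

Lemma hits_isolating H (D : {set T}) :
  D \subset vset H -> hits (neighbour H) k (vset H) D ->
  isolating (complete k r) H D.
Proof.
move=> sD /hitsP hD; rewrite /isolating sD; apply/forallP=> F1.
apply/implyP=> /andP[cF' HF']; have [Fk _] := is_copy_complete cF'.
have [sV _] := andP HF'; rewrite setI_eq0 cl_nbhd_setE; apply/negP.
exact: hD sV (copy_clique cF' HF') Fk.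
Qed.

(** Every edge of [H] is an [r]-subset of the common vertex set, and [F1] already has all of
    these. *)
Lemma copy_spanning H F1 : uniform r H -> #|vset H| = k ->
  is_copy (complete k r) F1 -> contains H F1 -> is_copy (complete k r) H.
Proof.
move=> uH Hk cF' /andP[sV sE]; have [Fk [f finj [EV EE]]] := is_copy_complete cF'.
have EVH : vset F1 = vset H by apply/eqP; rewrite eqEcard sV Hk Fk leqnn.
apply/existsP; exists f; apply/and3P; split.
- by apply/dinjectiveP=> i j _ _; apply: finj.
- by rewrite -EVH EV.
rewrite -EE eqEsubset sE andbT; apply/subsetP=> e He.
have Ee : f @: (f @^-1: e) = e.
  apply/setP=> x; apply/imsetP/idP=> [[i]|ex]; first by rewrite inE => ? ->.
  have: x \in vset F1 by rewrite EVH (subsetP (edge_sub He)).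
  by rewrite EV => /imsetP[i _ Ex]; exists i; rewrite // inE -Ex.
rewrite EE -Ee imset_f // inE -(card_imset _ finj) Ee.
by rewrite uH.
Qed.

End Complete.

(** * The 5-cycle as a hypergraph *)

Lemma cyc5_copy (T : finType) (H : hypergraph T) :
  uniform 2 H -> cyc5 (neighbour H) 2 (vset H) -> is_copy cycle5 H.
Proof.
move=> uH cH; have nsym := @neighbour_sym T H.
have [y Vy] : exists y, y \in vset H.
  by apply/set0Pn; case/cyc5P: cH => _ V5 _; rewrite -card_gt0 V5.
have [b [c [d [f [EV us [yb bc cd df yf] [yc yd bd bf cf]]]]]] :=
  cyc5_explicit nsym cH Vy.
pose s := [:: y; b; c; d; f].
pose g := [ffun i : 'I_5 => nth y s i].
have edge2 p q : p != q -> q \in nbhd (neighbour H) p -> [set p; q] \in eset H.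
  rewrite in_nbhd eq_sym => /negPf-> /andP[npq /exists_inP[e He /andP[ep eq]]].
  suff <- : e = [set p; q] by [].
  apply/eqP; rewrite eq_sym eqEcard subUset !sub1set ep eq uH // cards2.
  by rewrite eq_sym npq.
apply/existsP; exists g; apply/and3P; split.
- by apply/dinjectiveP=> i j _ _; rewrite !ffunE => /eqP; rewrite nth_uniq // => /eqP/val_inj.
- apply/eqP/setP=> x; rewrite EV in_set; apply/idP/imsetP.
    move=> sx; exists (Ordinal (etrans (index_mem x s) sx)); rewrite // ffunE nth_index //.
  by case=> i _ ->; rewrite ffunE mem_nth.
have gE (i : 'I_5) : g @: [set i; ordS i] = [set nth y s i; nth y s (i.+1 %% 5)].
  by rewrite imsetU !imset_set1 !ffunE.
have := us; rewrite /= !inE !negb_or.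
case/and5P=> [/and4P[nyb nyc nyd nyf] /and3P[nbc nbd nbf] /andP[ncd ncf] ndf _].
have fy : y \in nbhd (neighbour H) f by rewrite nbhd_sym.
have nfy : f != y by rewrite eq_sym.
rewrite eqEsubset; apply/andP; split; apply/subsetP=> e; last first.
  case/imsetP=> _ /imsetP[i _ ->] ->; rewrite gE.
  case: i => [[|[|[|[|[|//]]]]] ?]; [exact: (edge2 y b) | exact: (edge2 b c)
    | exact: (edge2 c d) | exact: (edge2 d f) | exact: (edge2 f y)].
move=> He; have /cards2P[p [q [npq Ee]]] : #|e| == 2 by rewrite uH.
have [ep eq] : p \in e /\ q \in e by rewrite Ee set21 set22.
have pq : q \in nbhd (neighbour H) p := edge_nbhd He ep eq.
have mem5 t : t \in e -> t \in s.
  by move/(subsetP (edge_sub He)); rewrite EV in_set.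
have edge m (lt5 : m < 5) : [set nth y s m; nth y s (m.+1 %% 5)]
    \in [set g @: (e : {set _}) | e in [set [set i; ordS i] | i : 'I_5]].
  rewrite -(gE (Ordinal lt5)); apply/imsetP.
  exists [set Ordinal lt5; ordS (Ordinal lt5)] => //.
  by apply/imsetP; exists (Ordinal lt5).
have [e0 e1 e2 e3 e4] := And5 (edge 0 isT) (edge 1 isT) (edge 2 isT) (edge 3 isT) (edge 4 isT).
rewrite Ee; move: npq pq (mem5 p ep) (mem5 q eq); rewrite !in_cons !in_nil !orbF.
(* Of the 25 pairs, the equal ones are excluded, the consecutive ones are edges of the cycle in one
   of two orders, and the others are not adjacent. *)
move=> npq pq /or4P[||| /orP[]] /eqP Ep /or4P[||| /orP[]] /eqP Eq; subst p q;
  rewrite ?eqxx // in npq;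
  try (by [exact: e0 | exact: e1 | exact: e2 | exact: e3 | exact: e4]);
  try (by rewrite setUC; first [exact: e0 | exact: e1 | exact: e2 | exact: e3 | exact: e4]).
all: have pq' := pq; rewrite (nbhd_sym nsym) in pq'.
all: by rewrite ?(negPf yc, negPf yd, negPf bd, negPf bf, negPf cf) in pq pq'.
Qed.

Lemma cycle5_degree (T : finType) (H : hypergraph T) x :
  is_copy cycle5 H -> x \in vset H -> #|[set w | neighbour H x w]| <= 2.
Proof.
case/existsP=> f /and3P[/dinjectiveP inj /eqP EV /eqP EE].
rewrite EV => /imsetP[j _ ->].
have finj : injective f by move=> i i'; apply: inj; rewrite inE.
apply: (@leq_trans #|[set f (ordS j); f (ord_pred j)]|); last first.
  by rewrite cards2; case: (_ != _).
apply/subset_leq_card/subsetP=> w; rewrite inE => /andP[nwj /exists_inP[e]].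
rewrite EE => /imsetP[_ /imsetP[i _ ->] ->] /andP[/imsetP[j' jj' /finj Ej]].
case/imsetP=> t tt Ew; move: jj' tt nwj; rewrite -Ej Ew.
case/set2P=> -> /set2P[]->; rewrite ?eqxx // => _.
  by rewrite set21.
by rewrite ordSK set22.
Qed.

Lemma cycle5_card (T : finType) (H : hypergraph T) :
  is_copy cycle5 H -> #|vset H| = 5.
Proof.
case/existsP=> f /and3P[/dinjectiveP inj /eqP-> _].
by rewrite card_in_imset ?cardsT ?card_ord.
Qed.

Section Bound.
Variables (T : finType) (r k : nat) (H : hypergraph T).
Hypotheses (r_gt1 : 1 < r) (le_rk : r <= k).
Hypotheses (uH : uniform r H) (coH : connected H).

Lemma isolation_bound :
  ~ (is_copy (complete k r) H \/ [/\ k = 2, r = 2 & is_copy cycle5 H]) ->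
  isolation_number (complete k r) H * k.+1 <= #|vset H|.
Proof.
move=> nexc; have k_gt1 : 1 < k by apply: leq_trans le_rk.
have F0 := complete_vset0 r_gt1 le_rk.
have [] := bounded_or_exc (@neighbour_sym T H) k_gt1 (connected_conn coH).
  case/boundedP=> D [sD hD cD]; apply: leq_trans cD; rewrite leq_mul2r orbC.
  by rewrite isolation_number_le // hits_isolating.
case/orP=> [/andP[/eqP Hk _]|c5]; last first.
  case: nexc; right; have [k2 _ _] := cyc5P _ _ _ c5.
  have r2 : r = 2 by apply/eqP; rewrite eqn_leq r_gt1 -k2 le_rk.
  by split=> //; apply: cyc5_copy; rewrite -?r2 // r2 -k2.
(* The shadow may be a [k]-clique although [H] is not a copy of [complete k r]; then [H] contains no
   copy at all. *)
suff : isolation_number (complete k r) H <= #|@set0 T|.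
  by rewrite cards0 leqn0 => /eqP->.
apply: isolation_number_le => //; rewrite /isolating sub0set.
apply/forallP=> F1; apply/implyP=> /andP[cF' HF']; case: nexc; left.
exact: copy_spanning cF' HF'.
Qed.

End Bound.

(** * Good hypergraphs *)

Lemma in_bigcup_nat (T : finType) (A : nat -> {set T}) m n x :
  reflect (exists2 i, m <= i < n & x \in A i) (x \in \bigcup_(m <= i < n) A i).
Proof.
have -> : (x \in \bigcup_(m <= i < n) A i) = has (fun i => x \in A i) (index_iota m n).
  by elim: (index_iota m n) => [|i l IHl]; rewrite ?big_nil ?big_cons inE //= IHl.
by apply: (iffP hasP) => -[i]; [rewrite mem_index_iota|]; exists i; rewrite // mem_index_iota.
Qed.

Lemma in_verts (T : finType) (v : nat -> T) m p x :
  reflect (exists2 i, m <= i <= p & x = v i) (x \in verts v m p).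
Proof.
rewrite inE; apply: (iffP mapP) => -[i]; first by rewrite mem_index_iota; exists i.
by move=> mip ->; exists i; rewrite // mem_index_iota.
Qed.

Section Good.
Variables (T U : finType) (r q s : nat) (F : hypergraph U) (H : hypergraph T).
Variables (v : nat -> T) (Fs : nat -> hypergraph T) (W : nat -> {set {set T}}).
Variables (Hs : nat -> hypergraph T) (T1 T2 : hypergraph T).
Hypothesis G : @good_construction U T r q s F H v Fs W Hs T1 T2.
Hypothesis q_gt0 : 0 < q.

Let FsQ i j : 1 <= i <= q -> 1 <= j <= q + s -> v j \notin vset (Fs i).
Proof.
move=> iq jq; apply/negP=> Fv; have := gc_disjQ G iq; move/disjointFr/(_ Fv).
by move/negP; apply; apply/in_verts; exists j.
Qed.

(** Edges of [T1] avoid [Fs i], those of [T2] can meet only [Fs q], and all others stay inside one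
    [Hs j]. The resulting zones are disjoint for distinct [i]; that of [q] is larger because of
    [T2]. *)
Lemma good_zone i x y : 1 <= i <= q -> y \in vset (Fs i) -> y \in cl_nbhd H x ->
  x \in vset (Fs i) \/
  exists2 j, x = v j & i <= j <= (if i == q then q + s else i).
Proof.
move=> iq Fy; rewrite !inE => /orP[/eqP<-|]; first by left.
case/andP=> _ /exists_inP[e]; have [i1 iq'] := andP iq.
have Q'y j : 1 <= j <= q + s -> y <> v j.
  by move=> jq Ey; case/negP: (FsQ iq jq); rewrite -Ey.
have Fyj j : 1 <= j <= q -> y \in v j |: vset (Fs j) -> j = i.
  move=> jq /setU1P[Ey|Fjy].
    by case: (Q'y j) => //; case/andP: jq => -> /leq_trans->; rewrite ?leq_addr.
  apply: contraTeq Fjy => nji; apply/negbT/(disjointFr _ Fy).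
  by apply: (gc_disj G) => //; rewrite eq_sym.
have inHs j : j = i -> x \in v j |: vset (Fs j) ->
    x \in vset (Fs i) \/ exists2 j, x = v j & i <= j <= (if i == q then q + s else i).
  move=> -> /setU1P[->|]; [right; exists i => // | by left].
  by rewrite leqnn /=; case: ifP => // _; apply: (leq_trans iq' (leq_addr _ _)).
rewrite (gc_eset G) !inE => /orP[/orP[He|He]|/in_bigcup_nat[j jq He]] /andP[ex ey].
- have := subsetP (edge_sub He) y ey; rewrite (gc_T1_vset G).
  by case/in_verts=> j jq /(Q'y _ jq).
- have qq : 1 <= q <= q by rewrite q_gt0 leqnn.
  have sT2 := subset_trans (edge_sub He) (gc_T2_vset_le G).
  have iq2 : q = i.
    have := subsetP sT2 y ey; rewrite (gc_vsetHs G qq) in_setU => /orP[].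
      case/in_verts=> j /andP[qj jq] /(Q'y j); case.
      by rewrite jq (leq_trans _ qj).
    exact: Fyj.
  have := subsetP sT2 x ex; rewrite (gc_vsetHs G qq) in_setU => /orP[|/inHs]; last exact.
  by case/in_verts=> j /andP[qj jq] ->; right; exists j; rewrite // -iq2 eqxx jq ltnW.
have jq' : 1 <= j <= q by [].
have := subsetP (edge_sub He); rewrite (gc_vsetHs G jq') => sub.
exact: inHs (Fyj j jq' (sub y ey)) (sub x ex).
Qed.

Lemma good_contains i : 1 <= i <= q -> contains H (Fs i).
Proof.
move=> iq; apply/andP; split; apply/subsetP=> x Fx.
  rewrite (gc_vset G) inE; apply/orP; right; apply/in_bigcup_nat; exists i => //.
  by rewrite (gc_vsetHs G iq) inE Fx orbT.
rewrite (gc_eset G) inE; apply/orP; right; apply/in_bigcup_nat; exists i => //.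
by rewrite (gc_esetHs G iq) inE Fx.
Qed.

Lemma good_isolation_ge D : isolating F H D -> q <= #|D|.
Proof.
case/andP=> sD /forallP iD.
pose P i x := (x \in D) && (cl_nbhd H x :&: vset (Fs i) != set0).
(* The default [v 0] is never taken for [1 <= i <= q], as [D] is isolating. *)
pose g i := odflt (v 0) [pick x | P i x].
have gP i : 1 <= i <= q -> P i (g i).
  move=> iq; rewrite /g; case: pickP => //= nP.
  have := iD (Fs i); rewrite (gc_copy G iq) (good_contains iq) /=.
  case/set0Pn=> y /setIP[/bigcupP[x Dx xy] Fy].
  have /negP[] := negbT (nP x); apply/andP; split=> //.
  by apply/set0Pn; exists y; rewrite inE xy.
have zone i : 1 <= i <= q -> g i \in vset (Fs i) \/
    exists2 j, g i = v j & i <= j <= (if i == q then q + s else i).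
  move=> iq; have /andP[_ /set0Pn[y /setIP[xy Fy]]] := gP i iq.
  exact: good_zone Fy xy.
have range i j : 1 <= i <= q -> i <= j <= (if i == q then q + s else i) ->
    1 <= j <= q + s.
  case/andP=> i1 iq /andP[ij]; rewrite (leq_trans i1 ij).
  by case: ifP => // _ /leq_trans-> //; apply: (leq_trans iq (leq_addr _ _)).
have inj : {in iota 1 q &, injective g}.
  move=> i j; rewrite !mem_iota !add1n !ltnS => iq jq Eg; apply/eqP.
  apply: contraT => nij.
  case: (zone i iq) (zone j jq) => [Fi|[a Ea ai]] [Fj|[b Eb bj]].
  - by rewrite Eg (disjointFr (gc_disj G jq iq _)) // eq_sym in Fi.
  - by rewrite Eg Eb (negPf (FsQ iq (range _ _ jq bj))) in Fi.
  - by rewrite -Eg Ea (negPf (FsQ jq (range _ _ iq ai))) in Fj.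
  (* The index ranges, from [q] to [q + s] for [q] and a single [i] otherwise, have no common
     element. *)
  have Eab : a = b.
    by apply: (gc_v_inj G); rewrite ?inE ?(range _ _ iq ai) ?(range _ _ jq bj) // -Ea -Eb.
  move: ai bj; rewrite Eab.
  by case: (i =P q) => [?|_]; case: (j =P q) => [?|_]; move: nij iq jq; lia.
rewrite -(size_iota 1 q) -(size_map g) cardE; apply: uniq_leq_size.
  by rewrite map_inj_in_uniq // iota_uniq.
move=> x /mapP[i]; rewrite mem_iota add1n ltnS => iq ->.
by rewrite mem_enum; case/andP: (gP i iq).
Qed.

(** [v 1] has three neighbours: [v 2] and [v 3] by edges of [T2], which all contain [v 1], and a
    vertex of [Fs 1] by an edge of [W 1]. *)
Lemma good_not_cycle5 : r = 2 -> q = 1 -> s = 2 -> ~ is_copy cycle5 H.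
Proof.
move=> r2 q1 s2 c5.
have iq : 1 <= 1 <= q by rewrite q1.
have vne i j : 1 <= i <= 3 -> 1 <= j <= 3 -> i != j -> v i != v j.
  move=> i3 j3; apply: contraNneq => /(gc_v_inj G)->; rewrite ?inE ?q1 ?s2 //.
have sVH : vset (Hs 1) \subset vset H.
  apply/subsetP=> x Hx; rewrite (gc_vset G) inE; apply/orP; right.
  by apply/in_bigcup_nat; exists 1.
have Hv1 : v 1 \in vset H.
  by apply: (subsetP sVH); rewrite (gc_vsetHs G iq) setU11.
have := cycle5_degree c5 Hv1; rewrite leqNgt; case/negP.
have T2v j : 1 < j <= 3 -> v j \in vset T2.
  move=> j23; apply: (subsetP (gc_T2_vset_ge G)); apply/in_verts; exists j => //.
  by rewrite q1 s2.
(* [v j] only serves to obtain, from the connectedness of [T2], an edge through [v i]. *)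
have nbT2 i j : 1 < i <= 3 -> 1 < j <= 3 -> i != j -> neighbour H (v 1) (v i).
  move=> i3 j3 nij; have vij : v i != v j by apply: vne => //; lia.
  have [e [es [ses ie _ _]]] := gc_T2_connected G (T2v i i3) (T2v j j3) vij.
  have eT2 : e \in eset T2 by apply: ses; rewrite mem_head.
  apply/andP; split; first by apply: vne; lia.
  apply/exists_inP; exists e; first by rewrite (gc_eset G) !inE eT2 orbT.
  by rewrite ie andbT -{1}q1 (gc_T2_eset G).
have [e We] := set0Pn _ (gc_W_neq0 G iq).
have [er sub v1e] := gc_W G iq We.
have [u] : exists u, u \in e :\ v 1.
  by apply/set0Pn; rewrite -card_gt0; move: er; rewrite r2 (cardsD1 (v 1)) v1e add1n => -[->].
case/setD1P=> nuv ue; have Fu : u \in vset (Fs 1).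
  by have := subsetP sub u ue; rewrite in_setU1 (negPf nuv).
have nbu : neighbour H (v 1) u.
  rewrite /neighbour nuv; apply/exists_inP; exists e; last by rewrite v1e.
  rewrite (gc_eset G) inE; apply/orP; right; apply/in_bigcup_nat; exists 1 => //.
  by rewrite (gc_esetHs G iq) inE We orbT.
have nuv' j : 1 <= j <= 3 -> v j != u.
  by move=> j3; apply: contraTneq Fu => <-; apply: FsQ; rewrite ?q1 ?s2.
have us : uniq [:: v 2; v 3; u] by rewrite /= !inE negb_or !nuv' // vne.
have <- : #|[set:: [:: v 2; v 3; u]]| = 3 by rewrite cardsE (card_uniqP us).
apply/subset_leq_card/subsetP=> w; rewrite !in_set !in_cons orbF.
by case/or3P=> /eqP-> //; [apply: (nbT2 2 3) | apply: (nbT2 3 2)].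
Qed.

End Good.

Theorem theorem1p3 (T : finType) (r k n : nat) (H : hypergraph T)
    (h2r : 2 <= r) (hrk : r <= k)
    (Hn : #|vset H| = n) (Hr : uniform r H) (Hc : connected H) :
  (~ (is_copy (complete k r) H \/ [/\ k = 2, r = 2 & is_copy cycle5 H]) ->
     ((isolation_number (complete k r) H)%:R <= n%:R / k.+1%:R :> rat)%R)
  /\ (good r n (complete k r) H ->
        isolation_number (complete k r) H = n %/ k.+1).
Proof.
split=> [nexc|].
  rewrite ler_pdivlMr ?ltr0n // -natrM ler_nat -Hn.
  exact: isolation_bound.
case; rewrite /= {1 2}/vset /= cardsT card_ord => _ _ _ _ gH.
have nexc : ~ (is_copy (complete k r) H \/ [/\ k = 2, r = 2 & is_copy cycle5 H]).
  case=> [cH|[k2 r2 c5]].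
    (* Here [n = k], so the quotient is 0 and the first case of goodness excludes a copy. *)
    have [Hk _] := is_copy_complete cH; case: gH => [[_ [_ _ ncH]]|[q0 _]].
      exact: ncH.
    by move: q0; rewrite -Hn Hk divn_small.
  (* With [n = 5] and [k = 2], the quotient is 1 and the remainder 2. *)
  move: gH; rewrite -Hn (cycle5_card c5) k2.
  case=> [[]//|[_ [v [Fs [W [Hs [T1 [T2 G]]]]]]]].
  exact: (good_not_cycle5 G) c5.
apply/eqP; rewrite eqn_leq leq_divRL // -{1}Hn isolation_bound //=.
apply: isolation_number_ge; first exact: complete_vset0 h2r hrk.
move=> D iD; case: gH => [[-> _]//|[q0 [v [Fs [W [Hs [T1 [T2 G]]]]]]]].
exact: (good_isolation_ge G).
Qed.
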